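(* Let $h\colon\mathbb{N}\to[1,\infty)$ be any function with $h(n)\to\infty$ as $n\to\infty$, and let $M_n=M_n^{(p_k,z_k)_k}$ be the randomized algorithm defined in the context. Let $\alpha>1/2$, let $\gamma=(\gamma_1,\gamma_2,\ldots)\in(0,1]^{\mathbb{N}}$ define product weights $\gamma_u=\prod_{j\in u}\gamma_j$, and let $\varepsilon>0$. Then there are positive constants $n_0=n_0(\alpha,\varepsilon,\gamma,d)$ and $C=C(\alpha,\varepsilon,\gamma,d)$ such that: (i) for every $n\ge n_0$, $$e^{\rm ran}_{d,\alpha,\gamma}(M_n)\le C\,n^{-\alpha-1/2+\varepsilon};$$ (ii) for every $n\ge 2$, with probability at least $1-n^{-h(n)}$ (over the random choice of $(p_k,z_k)_{k=1}^N$), the deterministic rule $M_n^{(p_k,z_k)_k}$ satisfies $$e^{\rm det}_{d,\alpha,\gamma}(M_n^{(p_k,z_k)_k})\le C\,n^{-\alpha+\varepsilon}.$$ Moreover, if $\sum_{j\ge1}\gamma_j^{1/\alpha}<\infty$, then $n_0$ and $C$ can be chosen independently of the dimension $d$.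
   Context: Dimension $d\in\mathbb{N}$; $\{1:m\}:=\{1,\ldots,m\}$. Weights: $\gamma=(\gamma_u)_{u}$ indexed by finite subsets $u\subset\mathbb{N}$, with $0<\gamma_u\le1$ and $\gamma_\emptyset=1$. For $h\in\mathbb{Z}^d$ let $\mathrm{supp}(h)=\{j:h_j\neq0\}$ and $r_{d,\alpha,\gamma}(h)=\gamma_{\mathrm{supp}(h)}^{-1}\prod_{j\in\mathrm{supp}(h)}|h_j|^{\alpha}$ (empty product $=1$). The weighted Korobov space $\mathcal{H}_{d,\alpha,\gamma}$ ($\alpha>1/2$) is the space of functions $f\colon[0,1]^d\to\mathbb{C}$ with absolutely convergent Fourier series $f(x)=\sum_{h\in\mathbb{Z}^d}\hat f(h)e^{2\pi i h\cdot x}$ and finite norm $\|f\|_{d,\alpha,\gamma}=\big(\sum_{h}r_{d,\alpha,\gamma}(h)^2|\hat f(h)|^2\big)^{1/2}$. $I_d(f)=\int_{[0,1]^d}f(x)\,dx$. For a prime $p$ and $z\in\{1:p-1\}^d$, the lattice rule is $Q_p^z(f)=\frac1p\sum_{k=0}^{p-1}f(\{kz/p\})$, where $\{\cdot\}$ is the componentwise fractional part. For a deterministic rule $A$, $e^{\rm det}_{d,\alpha,\gamma}(A)=\sup_{\|f\|_{d,\alpha,\gamma}\le1}|I_d(f)-A(f)|$. For a randomized rule $(A^\omega)_\omega$, $e^{\rm ran}_{d,\alpha,\gamma}(A)=\sup_{\|f\|_{d,\alpha,\gamma}\le1}\mathbb{E}_\omega|I_d(f)-A^\omega(f)|$. Algorithm: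 $\mathcal{P}_n$ is the set of primes in $[\lceil n/2\rceil+1,n]$; $h\colon\mathbb{N}\to[1,\infty)$ with $h(n)\to\infty$; $N=2\lceil h(n)\log_2 n\rceil+1$. For $k=1,\ldots,N$ independently, choose $p_k$ uniformly from $\mathcal{P}_n$ and then $z_k$ uniformly from $\{1:p_k-1\}^d$; set $M_n^{(p_k,z_k)_k}(f)=\mathrm{median}\{Q_{p_k}^{z_k}(f):1\le k\le N\}$, where the median of complex numbers is taken separately for real and imaginary parts (i.e. $\mathrm{median}\{a_k\}=\mathrm{median}\{\Re a_k\}+i\,\mathrm{median}\{\Im a_k\}$). *)

(* Defs.v *)
From HB Require Import structures.
From mathcomp Require Import all_boot all_order all_algebra.
From mathcomp Require Import all_classical all_reals all_analysis.
From mathcomp Require Import complex.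
Import Order.TTheory GRing.Theory Num.Theory.
Import numFieldNormedType.Exports.

Set Implicit Arguments.
Unset Strict Implicit.
Unset Printing Implicit Defensive.

Local Open Scope classical_set_scope.
Local Open Scope ring_scope.

Section Korobov.
Variable R : realType.

Definition cre (z : R[i]) : R := complex.Re z.
Definition cim (z : R[i]) : R := complex.Im z.
Definition cabs (z : R[i]) : R := Num.sqrt (cre z ^+ 2 + cim z ^+ 2).

Definition expi2pi (t : R) : R[i] := Complex (cos (2 * pi * t)) (sin (2 * pi * t)).

Definition midx (d : nat) := {ffun 'I_d -> int}.

Definition supp d (h : midx d) : {set 'I_d} := [set j | h j != 0].

(* product weights gamma_u = prod_{j in u} gamma_j ; the coordinate j : 'I_d
   (0-based) corresponds to the paper's coordinate j+1, with weight gamma (val j),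
   i.e. the sequence (gamma_1, gamma_2, ...) is (gamma 0, gamma 1, ...). *)
Definition prod_weight (gamma : nat -> R) d (u : {set 'I_d}) : R :=
  \prod_(j in u) gamma (val j).

Definition rweight d (alpha : R) (gu : {set 'I_d} -> R) (h : midx d) : R :=
  (gu (supp h))^-1 * \prod_(j in supp h) ((`|h j|%:~R : R) `^ alpha).

Definition dotp d (h : midx d) (x : 'I_d -> R) : R := \sum_(j < d) (h j)%:~R * x j.

Definition box_idx d K (g : {ffun 'I_d -> 'I_(K.*2.+1)}) : midx d :=
  [ffun j => (g j)%:Z - K%:Z].

Definition fourier_partial d (c : midx d -> R[i]) (K : nat) (x : 'I_d -> R) : R[i] :=
  \sum_(g : {ffun 'I_d -> 'I_(K.*2.+1)})
     c (box_idx g) * expi2pi (dotp (box_idx g) x).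

(* the sum of the (absolutely convergent) Fourier series, as the limit of the
   square partial sums (real and imaginary parts separately) *)
Definition fourier_fun d (c : midx d -> R[i]) (x : 'I_d -> R) : R[i] :=
  Complex (limn (fun K => cre (fourier_partial c K x)))
          (limn (fun K => cim (fourier_partial c K x))).

Definition abs_summable d (c : midx d -> R[i]) : Prop :=
  (\esum_(h in [set: midx d]) (cabs (c h))%:E < +oo)%E.

Definition korobov_norm d (alpha : R) (gu : {set 'I_d} -> R) (c : midx d -> R[i])
  : \bar R :=
  match (\esum_(h in [set: midx d]) ((rweight alpha gu h) ^+ 2 * (cabs (c h)) ^+ 2)%:E)%E
  with
  | r%:E => (Num.sqrt r)%:E
  | _ => +oo%E
  end.

(* unit ball of H_{d,alpha,gamma}: functions with absolutely convergent Fourier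
   series (coefficients c) and norm <= 1 *)
Definition korobov_ball d (alpha : R) (gu : {set 'I_d} -> R) : set (midx d -> R[i]) :=
  [set c | abs_summable c /\ (korobov_norm alpha gu c <= 1)%E].

Fixpoint iter_int (m : nat) (g : (nat -> R) -> R) : R :=
  match m with
  | 0 => g (fun _ => 0)
  | m'.+1 => Rintegral (@lebesgue_measure R) `[0%R, 1%R]
               (fun t => iter_int m' (fun x => g (fun j => if j == m' then t else x j)))
  end.

Definition integral_cube d (f : ('I_d -> R) -> R[i]) : R[i] :=
  Complex (iter_int d (fun x => cre (f (fun j => x (val j)))))
          (iter_int d (fun x => cim (f (fun j => x (val j))))).

Definition fracR (t : R) : R := t - (Num.floor t)%:~R.

Definition lattice_pt d (p : nat) (z : 'I_d -> nat) (k : nat) : 'I_d -> R :=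
  fun j => fracR ((k * z j)%:R / p%:R).

Definition lattice_rule d (p : nat) (z : 'I_d -> nat) (f : ('I_d -> R) -> R[i]) : R[i] :=
  (\sum_(k < p) f (lattice_pt p z k)) / p%:R.

Definition median (s : seq R) : R := nth 0 (sort <=%R s) (size s)./2.

Definition cmedian (s : seq R[i]) : R[i] :=
  Complex (median (map cre s)) (median (map cim s)).

Definition Nrep (h : nat -> R) (n : nat) : nat :=
  (absz (Num.ceil (h n * (ln (n%:R : R) / ln 2)))).*2.+1.

Definition primesP (n : nat) : {set 'I_n.+1} :=
  [set p : 'I_n.+1 | prime p && ((uphalf n).+1 <= p)%N].

(* an outcome: for each k < N a pair (p_k, z_k) (entries encoded in 'I_(n+1)) *)
Definition outcome (d n N : nat) := {ffun 'I_N -> 'I_n.+1 * {ffun 'I_d -> 'I_n.+1}}.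

(* probability of an outcome: the (p_k,z_k) are independent, p_k uniform on P_n,
   then z_k uniform on {1,...,p_k-1}^d *)
Definition outcome_prob d n N (w : outcome d n N) : R :=
  \prod_(k < N)
    (if ((w k).1 \in primesP n) && [forall j, (0 < (w k).2 j)%N && ((w k).2 j < (w k).1)%N]
     then ((#|primesP n|)%:R * (((w k).1 : nat).-1)%:R ^+ d)^-1
     else 0).

Definition Mn_rule d n N (w : outcome d n N) (f : ('I_d -> R) -> R[i]) : R[i] :=
  cmedian [seq lattice_rule ((w k).1 : nat) (fun j => ((w k).2 j : nat)) f | k <- enum 'I_N].

Definition err_det d (alpha : R) (gu : {set 'I_d} -> R)
  (A : (('I_d -> R) -> R[i]) -> R[i]) : \bar R :=
  ereal_sup [set (cabs (integral_cube (fourier_fun c) - A (fourier_fun c)))%:E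
            | c in korobov_ball alpha gu].

Definition err_ran_Mn d (alpha : R) (gu : {set 'I_d} -> R) (h : nat -> R) (n : nat)
  : \bar R :=
  ereal_sup [set (\sum_(w : outcome d n (Nrep h n))
                    outcome_prob w
                    * cabs (integral_cube (fourier_fun c) - Mn_rule w (fourier_fun c)))%:E
            | c in korobov_ball alpha gu].

Definition prob_det_err_le d (alpha : R) (gu : {set 'I_d} -> R) (h : nat -> R)
  (n : nat) (b : R) : R :=
  \sum_(w : outcome d n (Nrep h n) | `[< (err_det alpha gu (Mn_rule w) <= b%:E)%E >])
     outcome_prob w.

End Korobov.

Section Bounds.
Variable R : realType.
Local Open Scope ring_scope.

Definition Mn_error_bounds (alpha eps : R) (gamma : nat -> R) (d n0 : nat) (C : R)
  : Prop :=
  forall h : nat -> R, (forall n, 1 <= h n) -> h @ \oo --> +oo ->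
    (forall n : nat, (n0 <= n)%N ->
       (err_ran_Mn alpha (@prod_weight R gamma d) h n
          <= (C * (n%:R `^ (- alpha - 2^-1 + eps)))%:E)%E)
    /\
    (forall n : nat, (2 <= n)%N ->
       1 - (n%:R `^ (- h n))
         <= prob_det_err_le alpha (@prod_weight R gamma d) h n
              (C * (n%:R `^ (- alpha + eps)))).
End Bounds.

(* Main.v *)
(* Expanding f in its Fourier series, the lattice rule with prime p and generating vector
   z commits the error sum of fhat(h) over the nonzero h with p | h.z. A fixed h /= 0 is
   aliased in this way with probability O(n^(delta - 1)) times a small power of the
   entries of h, since (n/2, n] contains at least of the order n / log n primes (Erdos).
   Call a draw (p, z) bad if the sum of rho(h)^beta over the aliased h exceeds a multiple
   of n^(delta - 1), where rho = 1/r and beta is slightly larger than 1/alpha. By Markov,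
   bad draws have an arbitrarily small constant probability q, so at least half (or a
   quarter) of the N draws are bad with probability at most 2^N q^(N/2) (or q^(N/4)),
   which is a negative power of n. A good draw has worst-case error
   O(n^((delta - 1)/beta)), and so has the median whenever good draws form a majority. For
   the mean error of a fixed f, a good draw only aliases frequencies with rho(h)^beta below
   the threshold, and the first moment of its error over such h gives the additional
   n^(-1/2); the median is at most a constant times the average error of the good draws
   if at most a quarter of the draws are bad. *)
Require Import Defs.
From HB Require Import structures.
From mathcomp Require Import all_boot all_order all_algebra.
From mathcomp Require Import all_classical all_reals all_analysis.
From mathcomp Require Import complex zify ring lra.
Import Order.TTheory GRing.Theory Num.Theory.
Import numFieldNormedType.Exports.
Set Implicit Arguments.
Unset Strict Implicit.
Unset Printing Implicit Defensive.
Local Open Scope ring_scope.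

(** * Primes between n/2 and n *)

Section Primes.
Local Open Scope nat_scope.

Definition primorial n := \prod_(0 <= p < n.+1 | prime p) p.

Lemma dvdn_prod_primes (r : seq nat) N :
  uniq r -> (forall p, p \in r -> prime p /\ p %| N) -> \prod_(p <- r) p %| N.
Proof.
elim: r => [|p r IH] /=; first by rewrite big_nil dvd1n.
move=> /andP[pr ur] H; rewrite big_cons Gauss_dvd.
  have [_ ->] := H p (mem_head _ _).
  by apply: IH => // q qr; apply: H; rewrite inE qr orbT.
have [pp _] := H p (mem_head _ _).
rewrite prime_coprime // big_seq; apply: (big_ind (fun m => ~~ (p %| m))).
- by rewrite Euclid_dvd1.
- by move=> x y nx ny; rewrite Euclid_dvdM // negb_or nx.
move=> q qr; have [qp _] := H q (mem_behead (s := p :: r) qr).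
by rewrite dvdn_prime2 //; apply: contraNneq pr => ->.
Qed.

Lemma dvdn_prod_prime_interval a b N :
  (forall p, prime p -> a <= p < b -> p %| N) ->
  \prod_(a <= p < b | prime p) p %| N.
Proof.
move=> H; rewrite -big_filter; apply: dvdn_prod_primes.
  by rewrite filter_uniq // iota_uniq.
move=> p; rewrite mem_filter mem_index_iota => /andP[pp pab].
by split=> //; apply: H.
Qed.

Lemma prime_ndvdn_fact p n : prime p -> n < p -> ~~ (p %| n`!).
Proof.
move=> pp; elim: n => [|n IH] np; first by rewrite Euclid_dvd1.
by rewrite factS Euclid_dvdM // negb_or IH ?(ltnW np) // gtnNdvd.
Qed.

(** The prime occurs in [n]!, but in neither of the two factorials below it. *)
Lemma prime_dvdn_bin p n m :
  prime p -> m <= n -> m < p -> n - m < p -> p <= n -> p %| 'C(n, m).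
Proof.
move=> pp mn mp nmp pn.
have := bin_fact mn => E.
have : p %| n`! by rewrite dvdn_fact // prime_gt0.
rewrite -E Euclid_dvdM // Euclid_dvdM //.
by rewrite (negPf (prime_ndvdn_fact pp mp)) (negPf (prime_ndvdn_fact pp nmp)) !orbF.
Qed.

(** Two equal middle coefficients occur in the expansion of 2 ^ (2k + 1), so each is at most half of
    it. *)
Lemma bin_odd_le k : 'C(k.*2.+1, k) <= 4 ^ k.
Proof.
rewrite -(@leq_pmul2l 2) //.
have -> : 2 * 4 ^ k = 2 ^ k.*2.+1 by rewrite expnS -mul2n expnM.
have -> : 2 ^ k.*2.+1 = \sum_(i < k.*2.+2) 'C(k.*2.+1, i).
  rewrite -[2]/(1 + 1) expnDn; apply: eq_bigr => i _.
  by rewrite !exp1n !muln1.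
have hk : k < k.*2.+2 by lia.
have hk1 : k.+1 < k.*2.+2 by lia.
rewrite (bigD1 (Ordinal hk)) //= (bigD1 (Ordinal hk1)) /=; last first.
  by rewrite -val_eqE /=; lia.
rewrite addnA -[X in X <= _]addn0 leq_add //.
have -> : 'C(k.*2.+1, k.+1) = 'C(k.*2.+1, k).
  by rewrite -(@bin_sub _ k.+1); [congr ('C(_, _)); lia | lia].
by rewrite mul2n addnn.
Qed.

(** Strong induction. For odd n = 2k + 1 the primes in (k + 1, 2k + 1] all divide the binomial
    coefficient bounded by 4 ^ k, and the primes up to k + 1 are covered by induction; an even n > 2
    adds no prime. *)
Lemma primorial_le n : primorial n <= 4 ^ n.
Proof.
elim/ltn_ind: n => n IH.
case: n IH => [|n] IH; first by rewrite /primorial big_mkcond big_nat1.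
case: (boolP (odd n.+1 && (2 < n.+1))) => [/andP[on n2]|H].
  have [k nk k0] : exists2 k, n.+1 = k.*2.+1 & 0 < k.
    by exists n.+1./2; lia.
  rewrite nk /primorial (@big_cat_nat _ _ _ k.+2) //=; [|lia].
  have -> : k.*2.+1 = k.+1 + k by lia.
  rewrite expnD leq_mul //; first by apply: IH; lia.
  apply: leq_trans (bin_odd_le k); apply: dvdn_leq; first by rewrite bin_gt0; lia.
  apply: dvdn_prod_prime_interval => p pp /andP[p1 p2].
  by apply: prime_dvdn_bin => //; lia.
case: (eqVneq n.+1 2) => [->|n2].
  by rewrite /primorial big_mkcond /= unlock.
have np : ~~ prime n.+1.
  apply/negP => pn; case: (even_prime pn) => [/eqP|on]; first by rewrite (negPf n2).
  move: H; rewrite on /=; have := prime_gt1 pn; lia.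
rewrite /primorial big_mkcond big_nat_recr //= (negPf np) muln1 -big_mkcond /=.
by apply: leq_trans (IH n _) _ => //; rewrite leq_exp2l.
Qed.

Lemma central_bin_ge m : 0 < m -> 4 ^ m <= m.*2 * 'C(m.*2, m).
Proof.
elim: m => // -[_|m IH _]; first by [].
have {}IH := IH isT.
set a := m.+1 in IH *.
have E : a.+1 * 'C(a.+1.*2, a.+1) = 2 * a.*2.+1 * 'C(a.*2, a).
  have := mul_bin_diag a.+1.*2 a; rewrite doubleS /= => <-.
  have := mul_bin_down a.*2.+1 a; rewrite /= => h2.
  have {}h2 : a.*2.+1 * 'C(a.*2, a) = a.+1 * 'C(a.*2.+1, a).
    by rewrite h2; congr (_ * _); lia.
  by rewrite -mulnA h2 mulnA; congr (_ * _); lia.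
rewrite expnS.
have -> : a.+1.*2 * 'C(a.+1.*2, a.+1) = 2 * (a.+1 * 'C(a.+1.*2, a.+1)).
  by rewrite mulnA; congr (_ * _); lia.
rewrite E; apply: leq_trans (_ : 4 * (a.*2 * 'C(a.*2, a)) <= _).
  by rewrite leq_mul2l IH orbT.
rewrite !mulnA leq_mul2r; apply/orP; right; lia.
Qed.

Lemma logn_fact_widen p n N : prime p -> n <= N ->
  logn p n`! = \sum_(1 <= i < N.+1) n %/ p ^ i.
Proof.
move=> pp nN; rewrite logn_fact // (@big_cat_nat _ _ _ n.+1 1 N.+1) //=.
rewrite [X in _ = _ + X]big_nat_cond [X in _ = _ + X]big1 ?addn0 // => i /andP[/andP[ni _] _].
by rewrite divn_small // (leq_trans ni) // ltnW // ltn_expl // prime_gt1.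
Qed.

(** Legendre's formula for the three factorials, in additive form to avoid truncated subtraction. *)
Lemma logn_bin_sum p n m : prime p -> m <= n ->
  \sum_(1 <= i < n.+1) n %/ p ^ i =
  logn p 'C(n, m) + \sum_(1 <= i < n.+1) (m %/ p ^ i + (n - m) %/ p ^ i).
Proof.
move=> pp mn; rewrite big_split /= -!(logn_fact_widen pp) ?leq_subr //.
by rewrite -(bin_fact mn) !lognM ?muln_gt0 ?bin_gt0 ?fact_gt0.
Qed.

(** In Legendre's formula each power p ^ i <= n contributes at most one to the exponent and larger
    powers contribute nothing, so the exponent is at most the logarithm of n to base p. *)
Lemma expn_logn_bin p n m : prime p -> m <= n -> 0 < n -> p ^ logn p 'C(n, m) <= n.
Proof.
move=> pp mn n0; have p1 := prime_gt1 pp.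
suff H : logn p 'C(n, m) <= trunc_log p n.
  by apply: leq_trans (trunc_logP p1 n0); rewrite leq_exp2l.
have H1 : \sum_(1 <= i < n.+1) (p ^ i <= n : nat) <= trunc_log p n.
  have tn : trunc_log p n < n.+1.
    by rewrite ltnS ltnW // (leq_trans (ltn_expl _ p1)) // trunc_logP.
  rewrite (@big_cat_nat _ _ _ (trunc_log p n).+1) //=.
  rewrite [X in _ + X]big_nat_cond [X in _ + X]big1 ?addn0; last first.
    move=> i /andP[/andP[ti _] _]; apply/eqP; rewrite eqb0 -ltnNge.
    by apply: leq_trans (trunc_log_ltn n p1) _; rewrite leq_exp2l.
  apply: leq_trans (_ : \sum_(1 <= i < (trunc_log p n).+1) 1 <= _).
    by apply: leq_sum => i _; exact: leq_b1.
  by rewrite sum_nat_const_nat subSS subn0 muln1.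
apply: leq_trans H1.
rewrite -(leq_add2r (\sum_(1 <= i < n.+1) (m %/ p ^ i + (n - m) %/ p ^ i))).
rewrite -(logn_bin_sum pp mn) -big_split /=; apply: leq_sum => i _.
case: (leqP (p ^ i) n) => pin; last by rewrite divn_small.
have pi0 : 0 < p ^ i by rewrite expn_gt0 prime_gt0.
rewrite -{1}(subnKC mn) divnD // addnC leq_add2r.
exact: leq_b1.
Qed.

(** For 2m/3 < p <= m the quotients of 2m and m by p are 2 and 1 and cancel; higher powers of p
    exceed 2m. *)
Lemma logn_central_bin_eq0 p m : prime p -> 2 < p -> m.*2 < 3 * p -> p <= m ->
  logn p 'C(m.*2, m) = 0.
Proof.
move=> pp p2 mp pm.
have := logn_bin_sum pp (leq_trans (leq_addr m m) _ : m <= m.*2).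
rewrite addnn leqnn => /(_ isT).
have -> : m.*2 - m = m by lia.
suff -> : \sum_(1 <= i < m.*2.+1) m.*2 %/ p ^ i =
          \sum_(1 <= i < m.*2.+1) (m %/ p ^ i + m %/ p ^ i) by lia.
apply: eq_big_nat => i /andP[i1 _].
case: (eqVneq i 1) => [->|ni].
  rewrite expn1; have -> : m.*2 %/ p = 2.
    by apply/eqP; rewrite eqn_leq leq_divRL ?ltn_divLR -1?[_ <= 2]ltnS ?ltn_divLR ?prime_gt0 //; lia.
  by have -> : m %/ p = 1
    by apply/eqP; rewrite eqn_leq leq_divRL -1?[_ <= 1]ltnS ?ltn_divLR ?prime_gt0 //; lia.
have H : m.*2 < p ^ i.
  apply: leq_trans (_ : p ^ 2 <= _); last by rewrite leq_exp2l; lia.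
  rewrite -mulnn; nia.
by rewrite !divn_small //; lia.
Qed.

(** Erdos's splitting of the prime factors. Primes up to s contribute at most 2m each; primes above
    s occur at most once, those up to 2m/3 being controlled by the primorial; primes in (2m/3, m] do
    not occur; the primes in (m, 2m] are the ones to be counted. *)
Lemma central_bin_le m s : 0 < m -> m.*2 < s.+1 * s.+1 ->
  'C(m.*2, m) <= m.*2 ^ s * 4 ^ (m.*2 %/ 3)
                 * m.*2 ^ (\sum_(m.+1 <= p < m.*2.+1) prime p).
Proof.
move=> m0 ms; set B := 'C(m.*2, m).
have B0 : 0 < B by rewrite bin_gt0; lia.
have m20 : 0 < m.*2 by lia.
have primeB p : 0 < logn p B -> p <= m.*2.
  rewrite logn_gt0 mem_primes => /and3P[pp _ pB].
  rewrite leqNgt; apply/negP => mp; move: pB; apply/negP.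
  apply: contra (prime_ndvdn_fact pp mp) => pB.
  by rewrite -(@bin_fact _ m) ?dvdn_mulr //; lia.
have -> : B = \prod_(0 <= p < m.*2.+1) p ^ logn p B.
  rewrite -{1}(@partnT B) // (@widen_partn (maxn B m.*2)) ?leq_maxl //.
  rewrite (@big_cat_nat _ _ _ m.*2.+1) //=; last by rewrite ltnS leq_maxr.
  rewrite [X in _ * X]big_nat_cond [X in _ * X]big1 ?muln1 //.
  move=> p /andP[/andP[mp _] _]; case: (posnP (logn p B)) => [->//|/primeB].
  by rewrite leqNgt mp.
(* Each prime power is charged to one of three factors, the others being at least 1. *)
pose a p := if 0 < p <= s then m.*2 else 1.
pose b p := if prime p && (p <= m.*2 %/ 3) then p else 1.
pose c p := if prime p && (m < p) then m.*2 else 1.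
have gt01 : forall (t : bool) q, 0 < q -> 0 < (if t then q else 1) by case.
have a0 p : 0 < a p by apply: gt01.
have c0 p : 0 < c p by apply: gt01.
have b0 p : 0 < b p by rewrite /b; case: (boolP (prime p)) => //= /prime_gt0; apply: gt01.
apply: leq_trans (_ : \prod_(0 <= p < m.*2.+1) (a p * b p * c p) <= _).
  rewrite big_nat_cond [X in _ <= X]big_nat_cond; apply: leq_prod => p.
  rewrite andbT ltnS => /= p2m.
  case: (boolP (prime p)) => pp; last first.
    by rewrite lognE (negPf pp) expn0 !muln_gt0 a0 b0 c0.
  have le1 := expn_logn_bin pp (_ : m <= m.*2) m20.
  have {}le1 : p ^ logn p B <= m.*2 by apply: le1; lia.
  have := prime_gt1 pp => p1.
  case: (leqP p s) => ps.
    apply: leq_trans le1 _; rewrite /a ps (ltnW p1) -mulnA leq_pmulr //.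
    by rewrite muln_gt0 b0 c0.
  case: (ltnP m p) => mp.
    by apply: leq_trans le1 _; rewrite /c pp mp leq_pmull // muln_gt0 a0 b0.
  have lle : logn p B <= 1.
    rewrite leqNgt; apply/negP => l2; have : p ^ 2 <= m.*2.
      by apply: leq_trans le1; rewrite leq_exp2l.
    rewrite -mulnn; nia.
  case: (leqP p (m.*2 %/ 3)) => p3.
    apply: leq_trans (_ : p <= _); first by rewrite -[X in _ <= X]expn1 leq_exp2l.
    by rewrite /b pp p3 /= mulnAC leq_pmull // muln_gt0 a0 c0.
  case: (leqP p 2) => p2; last first.
    rewrite logn_central_bin_eq0 ?muln_gt0 ?a0 ?b0 ?c0 //.
    move: p3; rewrite ltn_divLR //; lia.
  (* The prime 2 would give s <= 1, hence 2m < 4, against 2 <= m. *)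
  have ep : p = 2 by lia.
  rewrite ep in ps mp p3 *; have s1 : s <= 1 by lia.
  exfalso; nia.
rewrite !big_split /= leq_mul ?leq_mul //.
- rewrite -big_mkcond /= big_const_seq iter_muln_1 leq_pexp2l //.
  rewrite -size_filter -[X in _ <= X](size_iota 1 s).
  apply: uniq_leq_size; first by rewrite filter_uniq // iota_uniq.
  by move=> p; rewrite mem_filter mem_index_iota mem_iota add1n ltnS => /andP[].
- apply: leq_trans (primorial_le _); rewrite /primorial.
  have h3 : (m.*2 %/ 3).+1 <= m.*2.+1 by rewrite ltnS leq_div.
  rewrite (@big_cat_nat _ _ _ (m.*2 %/ 3).+1 0 m.*2.+1) //=.
  rewrite [X in _ * X]big_nat_cond [X in _ * X]big1 ?muln1; last first.
    by move=> p /andP[/andP[mp _] _]; rewrite /b leqNgt mp andbF.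
  rewrite [X in _ <= X]big_mkcond big_nat_cond [X in _ <= X]big_nat_cond.
  by apply: leq_prod => p; rewrite andbT ltnS /b => /andP[_ ->]; rewrite andbT.
- have hm : m.+1 <= m.*2.+1 by lia.
  rewrite (@big_cat_nat _ _ _ m.+1 0 m.*2.+1) //=.
  rewrite [X in X * _]big_nat_cond [X in X * _]big1 ?mul1n; last first.
    by move=> p /andP[/andP[_ mp] _]; rewrite /c ltnNge -ltnS mp andbF.
  rewrite -big_mkcond /= big_const_seq iter_muln_1 leq_pexp2l //.
  rewrite -big_mkcond sum1_count leq_eqVlt; apply/orP; left; apply/eqP.
  apply: eq_in_count => p; rewrite mem_index_iota => /andP[mp _].
  by rewrite mp andbT.
Qed.

(** At L = 14 this reads 87 ^ 2 <= 2 ^ 13, and it fails at L = 13. *)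
Lemma sqr_lt_expn2 L : 13 < L -> (6 * L + 3) * (6 * L + 3) <= 2 ^ L.-1.
Proof.
elim: L => // L IH; rewrite ltnS leq_eqVlt => /orP[/eqP <-|L13]; first by [].
have := IH L13; case: L L13 {IH} => // L L13; rewrite /= expnS; nia.
Qed.

(** Comparing exponents of 2 in the lower and upper bounds of the central binomial coefficient gives
    2m <= L (1 + s + k) + 2 (2m/3), where s is the integer square root of 2m. Since s >= 6L + 3, the
    part 3 L (1 + s) is at most m. *)
Lemma sum_primes_central L m : 13 < L -> m.*2 <= 2 ^ L -> 2 ^ L.-1 <= m.*2 ->
  m.*2 <= 6 * L * \sum_(m.+1 <= p < m.*2.+1) prime p.
Proof.
move=> L13 mL Lm; set k := \sum_(_ <= _ < _) _.
have sq := sqr_lt_expn2 L13.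
have m0 : 0 < m by nia.
have [s s1 s2] : exists2 s, s * s <= m.*2 & m.*2 < s.+1 * s.+1.
  exists (Nat.sqrt m.*2); have := PeanoNat.Nat.sqrt_spec' m.*2; lia.
have sL : 6 * L + 3 <= s by rewrite -ltnS; nia.
have H : 2 ^ m.*2 <= 2 ^ (L * (1 + s + k) + (m.*2 %/ 3).*2).
  rewrite -[in X in X <= _]mul2n expnM; apply: leq_trans (central_bin_ge m0) _.
  apply: leq_trans (leq_mul (leqnn _) (central_bin_le m0 s2)) _.
  rewrite -/k expnD -[(_ %/ _).*2]mul2n (expnM 2 2) expnM !expnD expn1.
  rewrite [_ * _ * _ ^ k]mulnAC !mulnA leq_mul2r; apply/orP; right.
  have mono e : m.*2 ^ e <= (2 ^ L) ^ e by case: e => // e; rewrite leq_exp2r.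
  by rewrite !leq_mul.
rewrite leq_exp2l // in H.
have := leq_trunc_div m.*2 3; nia.
Qed.

Lemma card_primesP n : 1 < n ->
  #|primesP n| = \sum_((uphalf n).+1 <= p < (uphalf n).*2.+1) prime p.
Proof.
move=> n1; rewrite -sum1_card big_mkcond /=.
under eq_bigr => i _ do rewrite inE.
rewrite -(big_mkord xpredT (fun p => if prime p && (uphalf n < p) then 1 else 0)).
rewrite (@big_cat_nat _ _ _ (uphalf n).+1 0) //=; last by lia.
rewrite [X in X + _ = _]big_nat_cond [X in X + _ = _]big1 ?add0n; last first.
  by move=> p /andP[/andP[_ mp] _]; rewrite ltnNge -ltnS mp andbF.
rewrite (@big_cat_nat _ _ _ n.+1 (uphalf n).+1 (uphalf n).*2.+1) //=; [|lia..].
rewrite [X in _ = _ + X]big_nat_cond [X in _ = _ + X]big1 ?addn0; last first.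
  (* The doubled range can exceed n only by the number n + 1, which is then even and larger than
     2. *)
  move=> p /andP[/andP[mp pm] _]; apply/eqP; rewrite eqb0; apply/negP => pp.
  have [p2|op] := even_prime pp; lia.
by apply: eq_big_nat => p /andP[mp _]; rewrite mp andbT; case: (prime p).
Qed.

(** Where the chain first passes m, the previous entry is at most m and the new one at most twice
    that entry. *)
Lemma has_double_path c a m : path (fun x y => y <= x.*2) a c ->
  a <= m < last a c -> has (fun p => m < p <= m.*2) c.
Proof.
elim: c a => [|b c IH] a /=; first by move=> _; lia.
move=> /andP[ba pc] /andP[am ml]; case: (ltnP m b) => [mb|bm].
  by apply/orP; left; lia.
by rewrite (IH b) ?orbT // bm.
Qed.

Lemma bertrand_small m : 0 < m < 4999 -> exists2 p, prime p & m < p <= m.*2.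
Proof.
move=> m01.
pose c := [:: 2; 3; 5; 7; 13; 23; 43; 83; 163; 317; 631; 1259; 2503; 4999].
have /hasP[p pc mp] : has (fun p => m < p <= m.*2) c.
  by apply: (@has_double_path _ 1) => //; vm_compute.
exists p => //; have : all prime c by vm_compute.
by move/allP; apply.
Qed.

(* The constant [2 ^ 13] covers all [n < 2 ^ 13], where one prime is enough. *)
Lemma card_primesP_ge n : 1 < n ->
  n <= 2 ^ 13 * (trunc_log 2 n).+1 * #|primesP n|.
Proof.
move=> n1; rewrite card_primesP //; set L := (trunc_log 2 n).+1.
have /andP[Ln nL] := trunc_log_bounds (isT : 1 < 2) (ltnW n1 : 0 < n).
set m := uphalf n.
have nm : n <= m.*2 by rewrite /m; lia.
case: (ltnP 13 L) => L13.
  have mL : m.*2 <= 2 ^ L.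
    have : odd (2 ^ L) = false by rewrite expnS oddM.
    rewrite -/L in nL; lia.
  apply: (leq_trans nm); apply: leq_trans (sum_primes_central L13 mL _) _.
    exact: leq_trans Ln nm.
  by rewrite !leq_mul.
have n2 : n < 2 ^ 13 by apply: leq_trans nL _; rewrite leq_exp2l.
have m0 : 0 < m < 4999.
  apply/andP; split; first by lia.
  apply: leq_trans (_ : 2 ^ 12 < _); last by [].
  by move: n2; rewrite ltnS /m (expnS 2 12); move: (2 ^ 12) => t; lia.
have [p pp /andP[mp pm]] := bertrand_small m0.
apply: leq_trans (ltnW n2) _; rewrite -mulnA leq_pmulr // muln_gt0 /=.
clear -mp pm pp.
rewrite (@big_cat_nat _ _ _ p m.+1 m.*2.+1) //; last exact: ltnW.
by rewrite (@big_ltn _ _ _ p) ?ltnS // pp /= addnCA.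
Qed.

End Primes.

(** * Prime counts in terms of powers of n *)

Lemma log2_le_powR (R : realType) (delta : R) : 0 < delta ->
  exists2 c : R, 0 < c & forall (t : nat) (x : R), 2 ^+ t <= x ->
    t.+1%:R <= c * x `^ delta.
Proof.
move=> d0; have l2 : 0 < ln 2 :> R by rewrite ln_gt0 // ltr1n.
have dl : 0 < delta * ln 2 by rewrite mulr_gt0.
exists (1 + (delta * ln 2)^-1); first by rewrite addr_gt0 // invr_gt0.
move=> t x tx.
have x2 : 0 < 2 ^+ t :> R by rewrite exprn_gt0.
apply: le_trans (_ : (1 + (delta * ln 2)^-1) * (2 ^+ t) `^ delta <= _); last first.
  rewrite ler_wpM2l ?addr_ge0 ?invr_ge0 ?(ltW dl) //.
  apply: ge0_ler_powR => //; rewrite ?nnegrE ?(ltW d0) ?(ltW x2) //.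
  exact: le_trans (ltW x2) tx.
have -> : (2 ^+ t : R) `^ delta = expR (t%:R * (delta * ln 2)).
  rewrite /powR gt_eqF // lnXn // -[in LHS](mulr_natl _ t); congr expR.
  by ring.
apply: le_trans (_ : (1 + (delta * ln 2)^-1) * (1 + t%:R * (delta * ln 2)) <= _).
  move: (delta * ln 2) dl => a a0; have ai0 : 0 < a^-1 by rewrite invr_gt0.
  have E : a^-1 * (t%:R * a) = t%:R by rewrite mulrCA mulVf ?mulr1 ?gt_eqF.
  have := mulr_ge0 (ler0n R t) (ltW a0).
  rewrite mulrDl mul1r mulrDr mulr1 E -natr1; lra.
by rewrite ler_wpM2l ?expR_ge1Dx // addr_ge0 // invr_ge0 ltW.
Qed.

Lemma card_primesP_powR (R : realType) (delta : R) : 0 < delta ->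
  exists2 c : R, 0 < c & forall n, (1 < n)%N ->
    n%:R `^ (1 - delta) <= c * (#|primesP n|)%:R.
Proof.
move=> d0; have [c c0 Hc] := log2_le_powR d0.
exists ((2 ^ 13)%N%:R * c); first by rewrite mulr_gt0 // ltr0n expn_gt0.
move=> n n1; have n0 : (0 < n)%N by exact: ltnW.
have nR : 0 < n%:R :> R by rewrite ltr0n.
have nd : 0 < (n%:R : R) `^ delta by rewrite powR_gt0.
rewrite -(ler_pM2r nd) -powRD; last by rewrite (gt_eqF nR) implybT.
rewrite subrK powRr1 ?ler0n //.
have := card_primesP_ge n1; move: (2 ^ 13)%N => D.
rewrite -(ler_nat R) 2!natrM => /le_trans; apply.
rewrite -!mulrA ler_wpM2l ?ler0n // [leRHS]mulrCA [leLHS]mulrC.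
by rewrite ler_wpM2l ?ler0n // Hc // -natrX ler_nat trunc_logP.
Qed.

(** The product of the distinct primes counted divides a, and each of them is at least 2. *)
Lemma card_primesP_dvd n (a : nat) : (0 < a)%N ->
  (2 ^ #|[set p in primesP n | ((p : nat) %| a)%N]| <= a)%N.
Proof.
move=> a0; set S := [set _ in _ | _].
have H (p : nat) : p \in [seq val i | i <- enum S] -> prime p /\ (p %| a)%N.
  case/mapP => i; rewrite mem_enum inE => /andP[iP ia] ->; split=> //.
  by move: iP; rewrite inE => /andP[].
have := @dvdn_prod_primes [seq val i | i <- enum S] a.
rewrite map_inj_uniq ?enum_uniq; last exact: val_inj.
move=> /(_ isT H) /dvdn_leq; move/(_ a0); apply: leq_trans.
rewrite big_map big_enum /= -prod_nat_const; apply: leq_prod => i iS.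
by apply: prime_gt1; have [] := H (val i) (map_f _ _); rewrite ?mem_enum.
Qed.

(** * Random lattice rules *)

(** Membership of h in the dual lattice: at these frequencies the exponential equals 1 on all
    lattice points. *)
Definition dual_pt d (p : nat) (z : 'I_d -> nat) (h : midx d) : bool :=
  (p%:Z %| \sum_j h j * (z j)%:Z)%Z.

Section Draw.
Variables (d n : nat).

Definition draw := ('I_n.+1 * {ffun 'I_d -> 'I_n.+1})%type.

Definition in_dual (t : draw) (h : midx d) : bool :=
  dual_pt t.1 (fun j => t.2 j) h.

Definition gen_range (p : nat) : pred 'I_n.+1 := fun i => (0 < i < p)%N.

(** The type [draw] also contains pairs that the algorithm never chooses, such as those with p = 0;
    this is the support of the distribution. *)
Definition draw_ok (t : draw) : bool :=
  (t.1 \in primesP n) && [forall j, gen_range t.1 (t.2 j)].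

Lemma card_gen_range (p : 'I_n.+1) : #|gen_range p| = p.-1.
Proof.
rewrite -sum1_card big_mkcond /=.
rewrite -(big_mkord xpredT (fun i => if (0 < i < p)%N then 1%N else 0%N)).
case: (posnP p) => [->|p0].
  by rewrite big1 // => i _; rewrite ltn0 andbF.
have pn : (p <= n.+1)%N by rewrite ltnW.
rewrite (@big_cat_nat _ _ _ p) //= [X in (_ + X)%N]big_nat_cond.
rewrite [X in (_ + X)%N]big1 ?addn0; last first.
  by move=> i /andP[/andP[pi _] _]; rewrite [(i < p)%N]ltnNge pi andbF.
rewrite big_ltn //= add0n; transitivity (\sum_(1 <= i < p) 1)%N.
  by apply: eq_big_nat => i /andP[-> ->].
by rewrite sum_nat_const_nat muln1 subn1.
Qed.

Definition gens (p : nat) : {set {ffun 'I_d -> 'I_n.+1}} :=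
  [set z : {ffun 'I_d -> 'I_n.+1} | [forall j, gen_range p (z j)]].

Lemma card_gens (p : 'I_n.+1) : #|gens p| = (p.-1 ^ d)%N.
Proof.
rewrite -[in RHS](card_gen_range p) -[X in (_ ^ X)%N](card_ord d) -card_ffun_on.
apply: eq_card => z; rewrite inE.
by apply/forallP/ffun_onP => H j; apply: H.
Qed.

(** The remaining coordinates of a dual vector determine [z j0] modulo p, since p does not divide
    [h j0]. Hence overwriting coordinate [j0] by any of the p - 1 admissible values maps pairs of a
    dual vector and a value injectively into [gens p]. *)
Lemma card_gens_dual (p : 'I_n.+1) (h : midx d) (j0 : 'I_d) :
  prime p -> ~~ ((p : nat) %| `|h j0|)%N ->
  (#|[set z in gens p | in_dual (p, z) h]| * p.-1 <= p.-1 ^ d)%N.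
Proof.
move=> pp ph; rewrite -card_gens -card_gen_range -cardX.
pose f (u : {ffun 'I_d -> 'I_n.+1} * 'I_n.+1) : {ffun 'I_d -> 'I_n.+1} :=
  [ffun j => if j == j0 then u.2 else u.1 j].
rewrite -(@card_in_imset _ _ f); last first.
  move=> [z a] [z' a'] /=; rewrite !inE /= => /andP[/andP[/forallP zg zd] ag].
  move=> /andP[/andP[/forallP zg' zd'] ag'] /ffunP E.
  have aa : a = a' by have := E j0; rewrite !ffunE eqxx.
  have zz j : j != j0 -> z j = z' j by move=> jj; have := E j; rewrite !ffunE (negPf jj).
  congr pair => //; apply/ffunP => j; case: (eqVneq j j0) => [->{j}|]; last exact: zz.
  have : ((p : nat)%:Z %| h j0 * ((z j0 : nat)%:Z - (z' j0 : nat)%:Z))%Z.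
    have := rpredB zd zd'; rewrite /= -sumrB (bigD1 j0) //= big1 ?addr0.
      by rewrite -mulrBr.
    by move=> j jj; rewrite zz // subrr.
  rewrite dvdzE abszM Euclid_dvdM // (negPf ph) /= => pd.
  apply/val_inj => /=; move: (zg j0) (zg' j0) pd; rewrite /gen_range.
  move: (val (z j0)) (val (z' j0)) => x y /andP[x0 xp] /andP[y0 yp] pd.
  apply/eqP; apply: contraTT pd => xy; rewrite gtnNdvd //; lia.
apply: subset_leq_card; apply/fintype.subsetP => z /imsetP[[z' a]].
rewrite !inE /= => /andP[/andP[/forallP zg _] ag] ->.
by apply/forallP => j; rewrite ffunE; case: ifP => // _; apply: zg.
Qed.

Variable R : realType.

Definition draw_prob (t : draw) : R :=
  if draw_ok t then ((#|primesP n|)%:R * ((t.1 : nat).-1)%:R ^+ d)^-1 else 0.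

Lemma draw_prob_ge0 t : 0 <= draw_prob t.
Proof. by rewrite /draw_prob; case: ifP => // _; rewrite invr_ge0. Qed.

Lemma sum_draw_prob (f : draw -> bool) :
  \sum_(t | f t) draw_prob t =
  \sum_(p in primesP n) (#|primesP n|)%:R^-1 *
     ((#|[set z in gens p | f (p, z)]|)%:R / ((p : nat).-1)%:R ^+ d).
Proof.
rewrite [RHS]big_mkcond.
transitivity (\sum_p \sum_z (if f (p, z) then draw_prob (p, z) else 0)).
  rewrite pair_big /= [LHS]big_mkcond; apply: eq_bigr => -[p z] _ //.
apply: eq_bigr => p _; case: ifP => pP; last first.
  by rewrite big1 // => z _; rewrite /draw_prob /draw_ok /= pP; case: ifP.
rewrite -[#|[set _ in gens p | _]|]sum1_card natr_sum mulr_suml mulr_sumr [RHS]big_mkcond.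
apply: eq_bigr => z _; rewrite /draw_prob /draw_ok /= pP !inE.
case: (f (p, z)); rewrite ?andbT ?andbF //=.
by case: ifP => _ //; rewrite mul1r invfM.
Qed.

End Draw.

(** The aliasing probability grows with a power of one entry of h; the product over the support
    dominates it and factors over the coordinates, as the weighted sums require. *)
Definition freq_pow (R : realType) (d : nat) (delta : R) (h : midx d) : R :=
  \prod_(j in supp h) (`|h j|%:~R : R) `^ delta.

Lemma supp_ge1 (R : realType) d (h : midx d) j :
  j \in supp h -> 1 <= `|h j|%:~R :> R.
Proof. by rewrite inE => hj; rewrite ler1z; lia. Qed.

Lemma freq_pow_ge (R : realType) d (delta : R) (h : midx d) j :
  0 <= delta -> j \in supp h -> (`|h j|%:~R : R) `^ delta <= freq_pow delta h.
Proof.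
move=> d0 js; rewrite /freq_pow (bigD1 j) //= ler_peMr ?powR_ge0 //.
apply: (big_ind (fun x => 1 <= x)) => // [x y x1 y1|i /andP[iS _]].
  by rewrite mulr_ege1.
by have := ler_powR (supp_ge1 R iS) d0; rewrite powRr0.
Qed.

Lemma freq_pow_ge1 (R : realType) d (delta : R) (h : midx d) :
  0 <= delta -> 1 <= freq_pow delta h.
Proof.
move=> d0; apply: (big_ind (fun x => 1 <= x)) => // [x y x1 y1|i iS].
  by rewrite mulr_ege1.
by have := ler_powR (supp_ge1 R iS) d0; rewrite powRr0.
Qed.

Lemma card_primesP_gt0 n : (1 < n)%N -> (0 < #|primesP n|)%N.
Proof.
move=> n1; rewrite lt0n; apply/negP => /eqP P0.
by have := card_primesP_ge n1; rewrite P0 muln0; lia.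
Qed.

Lemma primesP_prime n (p : 'I_n.+1) : p \in primesP n -> prime p.
Proof. by rewrite inE => /andP[]. Qed.

Lemma sum_draw_prob1 (R : realType) d n : (1 < n)%N ->
  \sum_(t : draw d n) draw_prob R t = 1.
Proof.
move=> n1; rewrite (sum_draw_prob _ predT) (eq_bigr (fun=> (#|primesP n|)%:R^-1)).
  by rewrite sumr_const -[LHS]mulr_natr mulVf // pnatr_eq0 -lt0n card_primesP_gt0.
move=> p pP; have -> : [set z in gens d n p | predT (p, z)] = gens d n p.
  by apply/setP => z; rewrite inE andbT.
rewrite card_gens natrX divff ?mulr1 // expf_neq0 // pnatr_eq0.
by have := prime_gt1 (primesP_prime pP); lia.
Qed.

(* Either p divides all entries of h, which holds for at most log2 |h_j| of the
   primes in play, or the lattice condition has probability at most 1/(p-1) over z;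
   the factor [freq_pow] absorbs the logarithm. *)
Lemma draw_prob_in_dual (R : realType) (delta : R) : 0 < delta ->
  exists2 K : R, 0 < K & forall d n (h : midx d), (1 < n)%N -> supp h != finset.set0 ->
    \sum_(t : draw d n | in_dual t h) draw_prob R t
      <= K * freq_pow delta h * n%:R `^ (delta - 1).
Proof.
move=> d0; have [c1 c10 Hc1] := log2_le_powR d0.
have [c2 c20 Hc2] := card_primesP_powR d0.
exists (c1 * c2 + 2) => [|d n h n1 /set0Pn[j0 hj0]]; first by rewrite addr_gt0 ?mulr_gt0.
have nR : 0 < n%:R :> R by rewrite ltr0n; lia.
have P0 : 0 < #|primesP n|%:R :> R by rewrite ltr0n card_primesP_gt0.
set nd := n%:R `^ (delta - 1).
have nd0 : 0 < nd by rewrite powR_gt0.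
have W1 := freq_pow_ge1 h (ltW d0).
have Pinv : (#|primesP n|%:R : R)^-1 <= c2 * nd.
  have := Hc2 n n1; rewrite -opprB powRN -/nd => H.
  rewrite -[leLHS]mul1r ler_pdivrMr // mulrAC -ler_pdivrMr // mul1r.
  exact: H.
have ninv : (n%:R : R)^-1 <= nd.
  rewrite -powR_inv1 ?ler0n //; apply: ler_powR; last by lra.
  by rewrite ler1n ltnW.
have H0 : (`|h j0| > 0)%N by rewrite absz_gt0; move: hj0; rewrite inE.
pose S := [set p in primesP n | ((p : nat) %| `|h j0|)%N].
have Sle : #|S|%:R <= c1 * freq_pow delta h.
  have := card_primesP_dvd n H0; rewrite -/S -(ler_nat R) natrX => /Hc1 H.
  apply: le_trans (_ : _ <= #|S|.+1%:R) _; first by rewrite ler_nat.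
  apply: (le_trans H); rewrite ler_wpM2l ?(ltW c10) //.
  apply: le_trans (freq_pow_ge (ltW d0) hj0).
  by rewrite -[in leRHS]abszE.
rewrite sum_draw_prob.
(* The second summand bounds 1/(p - 1), because p - 1 >= n/2 for every admissible prime. *)
apply: le_trans (_ : \sum_(p in primesP n) #|primesP n|%:R^-1 *
   ((((p : nat) %| `|h j0|)%N : nat)%:R + 2 / n%:R) <= _).
  apply: ler_sum => p pP; rewrite ler_wpM2l ?invr_ge0 //.
  have pp := primesP_prime pP; have p1 := prime_gt1 pp.
  have p10 : (0 < (p : nat).-1)%N by rewrite -subn1 subn_gt0.
  have D0 : 0 < ((p : nat).-1)%:R ^+ d :> R by rewrite exprn_gt0 // ltr0n.
  rewrite ler_pdivrMr //; case: (boolP (_ %| _)%N) => pd /=.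
    apply: le_trans (_ : _ <= ((p : nat).-1)%:R ^+ d) _.
      rewrite -natrX -card_gens ler_nat; apply: subset_leq_card.
      by apply/fintype.subsetP => z; rewrite inE => /andP[].
    by rewrite ler_peMl ?(ltW D0) // lerDl divr_ge0.
  have := card_gens_dual pp pd; rewrite -(ler_nat R) natrM natrX => H.
  rewrite add0r mulrAC ler_pdivlMr //; apply: le_trans (ler_wpM2l _ H) => //.
  rewrite mulrCA ler_wpM2l // -natrM ler_nat.
  by move: pP; rewrite inE => /andP[_]; clear; lia.
rewrite -mulr_sumr big_split /= sumr_const.
have -> : \sum_(p in primesP n) (((p : nat) %| `|h j0|)%N : nat)%:R = #|S|%:R :> R.
  rewrite -natr_sum; congr _%:R; rewrite -sum1_card [RHS]big_mkcond [LHS]big_mkcond.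
  apply: eq_bigr => p _; rewrite [in RHS]inE; case: (p \in _) => //=.
rewrite mulrDr -[(_ / _) *+ _]mulr_natr [X in _ + X]mulrC mulfK ?gt_eqF //.
have -> : (c1 * c2 + 2) * freq_pow delta h * nd =
  c1 * c2 * freq_pow delta h * nd + 2 * (freq_pow delta h * nd) by ring.
rewrite lerD //.
  have -> : c1 * c2 * freq_pow delta h * nd = (c1 * freq_pow delta h) * (c2 * nd) by ring.
  by rewrite mulrC; apply: ler_pM => //; rewrite invr_ge0.
rewrite ler_wpM2l //; apply: (le_trans ninv).
by rewrite ler_peMl // ltW.
Qed.

(** * Sums over boxes of frequencies *)

Section BoxSum.
Variables (R : realType) (d : nat).
Implicit Types (F G : midx d -> R) (h : midx d).

(** The cubes are those of [fourier_partial]; infinite sums enter only as limits in K or as bounds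
    uniform in K. *)
Definition bsum (K : nat) F : R :=
  \sum_(g : {ffun 'I_d -> 'I_(K.*2.+1)}) F (box_idx g).

Definition box_seq (K : nat) : seq (midx d) :=
  [seq box_idx g | g : {ffun 'I_d -> 'I_(K.*2.+1)}].

Lemma bsum_seq K F : bsum K F = \sum_(h <- box_seq K) F h.
Proof. by rewrite big_map big_enum. Qed.

Lemma box_idx_inj K : injective (@box_idx d K).
Proof.
move=> g g' /ffunP E; apply/ffunP => j; apply: val_inj => /=.
by have := E j; rewrite !ffunE; lia.
Qed.

Lemma uniq_box_seq K : uniq (box_seq K).
Proof. by rewrite map_inj_uniq ?enum_uniq //; exact: box_idx_inj. Qed.

Lemma mem_box_seq K h : (h \in box_seq K) = [forall j, (`|h j| <= K)%N].
Proof.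
apply/idP/forallP => [/mapP[g _ ->] j|H].
  by rewrite ffunE; case: (g j) => x xK /=; lia.
have gP j : (absz (h j + K%:Z)%R < K.*2.+1)%N by have := H j; lia.
apply/mapP; exists [ffun j => Ordinal (gP j)]; first by rewrite mem_enum.
apply/ffunP => j; rewrite !ffunE /=.
by have := H j; lia.
Qed.

Lemma sub_box_seq K K' : (K <= K')%N -> {subset box_seq K <= box_seq K'}.
Proof.
move=> KK h; rewrite !mem_box_seq => /forallP H; apply/forallP => j.
exact: leq_trans (H j) KK.
Qed.

Lemma ler_bsum K F G : (forall h, F h <= G h) -> bsum K F <= bsum K G.
Proof. by move=> FG; apply: ler_sum. Qed.

Lemma bsum_ge0 K F : (forall h, 0 <= F h) -> 0 <= bsum K F.
Proof. by move=> F0; apply: sumr_ge0. Qed.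

Lemma eq_bsum K F G : F =1 G -> bsum K F = bsum K G.
Proof. by move=> FG; apply: eq_bigr. Qed.

Lemma bsumD K F G : bsum K (fun h => F h + G h) = bsum K F + bsum K G.
Proof. by rewrite /bsum big_split. Qed.

Lemma bsumB K F G : bsum K (fun h => F h - G h) = bsum K F - bsum K G.
Proof. by rewrite /bsum sumrB. Qed.

Lemma bsumZ K a F : bsum K (fun h => a * F h) = a * bsum K F.
Proof. by rewrite /bsum mulr_sumr. Qed.

Lemma ler_norm_bsum K F : `|bsum K F| <= bsum K (fun h => `|F h|).
Proof. exact: ler_norm_sum. Qed.

Lemma bsum_nondecreasing F : (forall h, 0 <= F h) ->
  {homo bsum ^~ F : K K' / (K <= K')%N >-> K <= K'}.
Proof.
move=> F0 K K' KK; rewrite !bsum_seq [leRHS](bigID (mem (box_seq K))) /=.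
rewrite -[leLHS]addr0 lerD ?sumr_ge0 //.
rewrite -[leRHS]big_filter le_eqVlt; apply/orP; left; apply/eqP.
apply: perm_big; apply: uniq_perm; rewrite ?filter_uniq ?uniq_box_seq //.
move=> h; rewrite mem_filter; case hK: (h \in box_seq K) => //=.
by rewrite (sub_box_seq KK).
Qed.

(** The positive and negative parts of F have nondecreasing bounded box sums. *)
Lemma bsum_is_cvg F B : (forall K, bsum K (fun h => `|F h|) <= B) ->
  cvgn (bsum ^~ F).
Proof.
move=> FB.
pose Fp h := (`|F h| + F h) / 2; pose Fn h := (`|F h| - F h) / 2.
have cvgp (G : midx d -> R) : (forall h, 0 <= G h <= `|F h|) -> cvgn (bsum ^~ G).
  move=> GF; apply: nondecreasing_is_cvgn.
    by apply: bsum_nondecreasing => h; have /andP[] := GF h.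
  exists B => _ [K _ <-]; apply: le_trans (FB K); apply: ler_bsum => h.
  by have /andP[] := GF h.
have -> : bsum ^~ F = (fun K => bsum K Fp - bsum K Fn).
  by apply/funext => K; rewrite -bsumB; apply: eq_bsum => h; rewrite /Fp /Fn; lra.
apply: is_cvgB; apply: cvgp => h; rewrite /Fp /Fn.
  by have := ler_norm (F h); have := lerNnormlW (lexx `|F h|); lra.
by have := ler_norm (F h); have := lerNnormlW (lexx `|F h|); lra.
Qed.

Lemma bsum_supp0 K F :
  bsum K (fun h => if supp h == finset.set0 then F h else 0) = F [ffun=> 0].
Proof.
pose g0 : {ffun 'I_d -> 'I_(K.*2.+1)} := [ffun=> inord K].
have K1 : (K < K.*2.+1)%N by lia.
have g00 : box_idx g0 = [ffun=> 0].
  by apply/ffunP => j; rewrite !ffunE inordK // subrr.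
have s0 : supp ([ffun=> 0] : midx d) == finset.set0.
  by apply/eqP/setP => j; rewrite !inE ffunE.
rewrite /bsum (bigD1 g0) //= g00 s0 big1 ?addr0 // => g gg0.
case: ifP => // /eqP sg; case/eqP: gg0; apply: box_idx_inj; rewrite g00.
apply/ffunP => j; have : j \notin supp (box_idx g) by rewrite sg inE.
by rewrite inE negbK => /eqP ->; rewrite ffunE.
Qed.

Lemma bsum_prod K (f : 'I_d -> int -> R) :
  bsum K (fun h => \prod_j f j (h j)) = \prod_j \sum_(i < K.*2.+1) f j (i%:Z - K%:Z).
Proof.
rewrite bigA_distr_bigA /=; apply: eq_bigr => g _; apply: eq_bigr => j _.
by rewrite ffunE.
Qed.

Lemma bsum_le_esum K F : (forall h, 0 <= F h) ->
  ((bsum K F)%:E <= \esum_(h in [set: midx d]) (F h)%:E)%E.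
Proof.
move=> F0; apply: esum_ge; exists [set` box_seq K]%classic.
  by split => //; exact: finite_seq.
by rewrite -fsbig_seq ?uniq_box_seq // bsum_seq sumEFin.
Qed.

End BoxSum.

Arguments bsum {R d} K F.

(** * Fourier series and lattice rules *)

Lemma cos_sin_2pi_nat (R : realType) (k : nat) :
  cos (2 * pi * k%:R) = 1 :> R /\ sin (2 * pi * k%:R) = 0 :> R.
Proof.
have E : 2 * pi * k%:R = 0 + (pi *+ 2) *+ k :> R.
  by rewrite add0r -mulrA mulr_natl -[in RHS]mulrnA mulnC mulrnA mulr_natr.
by rewrite E (periodicn (@cosD2pi R)) (periodicn (@sinD2pi R)) cos0 sin0.
Qed.

Lemma cos_sin_2pi_int (R : realType) (k : int) :
  cos (2 * pi * k%:~R) = 1 :> R /\ sin (2 * pi * k%:~R) = 0 :> R.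
Proof.
case: (intP k) => [|n|n]; first by rewrite mulr0 cos0 sin0.
  exact: cos_sin_2pi_nat.
have [c s] := cos_sin_2pi_nat R n.+1.
by rewrite mulrNz mulrN cosN sinN s oppr0.
Qed.

(** * Integrals of single trigonometric terms *)

Section TrigIntegral.
Variable R : realType.
Let mu := @lebesgue_measure R.

(** The real part of (a - i b) exp(2 pi i t). Real and imaginary parts of a Fourier term both have
    this form, and a shift of t only changes the coefficients. *)
Definition trig (a b t : R) : R := a * cos (2 * pi * t) + b * sin (2 * pi * t).

Lemma trigD a b s t : trig a b (s + t) =
  trig (trig a b t) (trig b (- a) t) s.
Proof. by rewrite /trig mulrDr cosD sinD; ring. Qed.

Lemma ler_norm_trig a b t : `|trig a b t| <= `|a| + `|b|.
Proof.
apply: le_trans (ler_normD _ _) _; rewrite !normrM lerD // ler_piMr //.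
  exact: cos_max.
exact: sin_max.
Qed.

Lemma continuous_trig a b w : continuous (fun t : R => trig a b (w * t)).
Proof.
move=> t; apply: differentiable_continuous; apply/derivable1_diffP.
by rewrite /trig; apply: ex_derive.
Qed.

Lemma integrable_trig a b w :
  mu.-integrable `[0, 1]%classic (EFin \o (fun t : R => trig a b (w * t))).
Proof.
apply: continuous_compact_integrable; first exact: segment_compact.
by apply: continuous_subspaceT => t; exact: continuous_trig.
Qed.

Lemma integral_trig a b (k : int) :
  (\int[mu]_(t in `[0%R, 1%R]) (trig a b (k%:~R * t))%:E =
   (if k == 0 then a else 0)%:E)%E.
Proof.
pose w : R := 2 * pi * k%:~R.
pose F (t : R) := if k == 0 then a * t else a / w * sin (w * t) - b / w * cos (w * t).
have dF (t : R) : is_derive t 1 F (trig a b (k%:~R * t)).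
  rewrite /F; case: eqP => [->|/eqP k0].
    by apply: is_derive_eq; rewrite /trig mul0r mulr0 cos0 sin0 /GRing.scale /=; ring.
  have w0 : w != 0 by rewrite !mulf_neq0 ?intr_eq0 // gt_eqF // pi_gt0.
  have E : 2 * pi * (k%:~R * t) = w * t by rewrite /w; ring.
  apply: is_derive_eq; rewrite /trig E /GRing.scale /=; field; exact: w0.
rewrite (@continuous_FTC2 _ _ F) //.
- rewrite /F -EFinB; case: eqP => [_|_]; first by rewrite mulr0 mulr1 subr0.
  have [c s] := cos_sin_2pi_int R k.
  by rewrite !mulr0 mulr1 /w c s cos0 sin0; congr EFin; ring.
- by apply: continuous_subspaceT => t; exact: continuous_trig.
- have cF : continuous F.
    by move=> t; apply: differentiable_continuous; apply/derivable1_diffP; case: (dF t).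
  split => [t _||]; first by case: (dF t).
  + exact: cvg_at_right_filter (cF 0).
  + exact: cvg_at_left_filter (cF 1).
- by move=> t _; rewrite derive1E; case: (dF t).
Qed.

End TrigIntegral.

(** * Termwise integration over the cube *)

Section IteratedIntegral.
Variables (R : realType) (d : nat).
Local Open Scope classical_set_scope.
Local Open Scope ring_scope.
Let mu := @lebesgue_measure R.

Definition pdot (m : nat) (h : midx d) (y : nat -> R) : R :=
  \sum_(j < d | (j < m)%N) (h j)%:~R * y j.

Definition supp_ge (m : nat) (h : midx d) : bool :=
  [forall j : 'I_d, (j < m)%N ==> (h j == 0)].

Lemma pdotS m (md : (m < d)%N) h (y : nat -> R) t :
  pdot m.+1 h (fun j => if j == m then t else y j) =
  pdot m h y + (h (Ordinal md))%:~R * t.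
Proof.
rewrite /pdot (bigD1 (Ordinal md)) //= eqxx addrC; congr (_ + _).
apply: eq_big => [j|j /andP[_]]; first by rewrite -val_eqE /=; lia.
by rewrite -val_eqE /= => /negPf ->.
Qed.

Lemma supp_geS m (md : (m < d)%N) h :
  supp_ge m.+1 h = (h (Ordinal md) == 0) && supp_ge m h.
Proof.
apply/forallP/andP => [H|[hm /forallP H] j].
  have := H (Ordinal md); rewrite /= ltnSn /= => ->; split => //.
  by apply/forallP => j; apply/implyP => jm; have /implyP := H j; apply; exact: ltnW.
apply/implyP; rewrite ltnS leq_eqVlt => /orP[/eqP jm|jm]; last by apply: implyP jm.
by have -> : j = Ordinal md by exact: val_inj.
Qed.

(** Dominated convergence with the constant B exchanges limit and integral; integration in
    coordinate m then removes every frequency with a nonzero entry there. The predicate P records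
    the frequencies that survive the inner integrations. *)
Lemma integral_lim_bsum_trig m (md : (m < d)%N) (P : pred (midx d))
    (a b : midx d -> R) B :
  (forall K, bsum K (fun h => `|a h| + `|b h|) <= B) ->
  Rintegral mu `[0, 1]%classic (fun t : R => limn (bsum ^~ (fun h =>
    if P h then trig (a h) (b h) ((h (Ordinal md))%:~R * t) else 0))) =
  limn (bsum ^~ (fun h => if P h && (h (Ordinal md) == 0) then a h else 0)).
Proof.
move=> abB.
pose f (t : R) h := if P h then trig (a h) (b h) ((h (Ordinal md))%:~R * t) else 0.
pose g h := if P h && (h (Ordinal md) == 0) then a h else 0.
rewrite -/(f _) -/g.
have fB t K : bsum K (fun h => `|f t h|) <= B.
  apply: le_trans (abB K); apply: ler_bsum => h; rewrite /f.
  by case: (P h); rewrite ?normr0 ?addr_ge0 // ler_norm_trig.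
have gB K : bsum K (fun h => `|g h|) <= B.
  apply: le_trans (abB K); apply: ler_bsum => h; rewrite /g.
  by case: (_ && _); rewrite ?normr0 ?addr_ge0 // lerDl.
have term_int h : mu.-integrable `[0, 1]%classic (EFin \o (fun t : R => f t h)).
  rewrite /f; case: (P h); first exact: integrable_trig.
  exact: integrable0.
have bsum_int K : mu.-integrable `[0, 1]%classic (EFin \o (fun t : R => bsum K (f t))).
  have -> : EFin \o (fun t : R => bsum K (f t)) =
      (fun t => \sum_(i : {ffun 'I_d -> 'I_(K.*2.+1)}) (f t (box_idx i))%:E)%E.
    by apply/funext => t; rewrite /= sumEFin.
  by apply: integrable_sum => // i _; exact: (term_int (box_idx i)).
have int_bsum K : (\int[mu]_(t in `[0%R, 1%R]) (bsum K (f t))%:E = (bsum K g)%:E)%E.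
  transitivity (\int[mu]_(t in `[0%R, 1%R]) (\sum_(i : {ffun 'I_d -> 'I_(K.*2.+1)}) (f t (box_idx i))%:E))%E.
    by apply: eq_integral => t _; rewrite sumEFin.
  rewrite integral_sum //; last by move=> i; exact: term_int.
  rewrite /bsum -sumEFin; apply: eq_bigr => i _; rewrite /f /g.
  by case: (P _) => /=; [exact: integral_trig|exact: integral0].
have cf t : (fun K => (bsum K (f t))%:E) @ \oo --> (limn (bsum ^~ (f t)))%:E.
  by apply: cvg_EFin; [exact: nearW|exact: bsum_is_cvg (fB t)].
have mf K := measurable_int mu (bsum_int K).
have intB : mu.-integrable `[0, 1]%classic (cst B%:E).
  apply/integrableP; split; first exact: measurable_cst.
  rewrite integral_cst //= lebesgue_measure_itv /= lte_fin ltr01.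
  by rewrite oppr0 adde0 mule1 ltry.
have H := dominated_cvg (mu := mu) (measurable_itv _) mf (fun t _ => cf t) _ intB.
have {}H := H (fun _ _ => erefl) (fun K t _ => le_trans (ler_norm_bsum K (f t)) (fB t K)).
have H2 : (fun K => (bsum K g)%:E) @ \oo --> (limn (bsum ^~ g))%:E.
  by apply: cvg_EFin; [exact: nearW|exact: bsum_is_cvg gB].
have -> : limn (bsum ^~ g) = fine (limn (bsum ^~ g))%:E by [].
congr fine; apply: cvg_unique (H) _ => //.
by rewrite (_ : (fun K => _) = fun K => (bsum K g)%:E) //; apply/funext => K; exact: int_bsum.
Qed.

Lemma iter_int_trig m (a b : midx d -> R) B : (m <= d)%N ->
  (forall K, bsum K (fun h => `|a h| + `|b h|) <= B) ->
  iter_int m (fun y => limn (bsum ^~ (fun h => trig (a h) (b h) (pdot m h y)))) =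
  limn (bsum ^~ (fun h => if supp_ge m h then a h else 0)).
Proof.
elim: m a b B => [|m IH] a b B md abB.
  congr (limn _); apply/funext => K; apply: eq_bsum => h /=.
  rewrite /trig /pdot big_pred0 // mulr0 cos0 sin0 mulr1 mulr0 addr0.
  by rewrite ifT //; apply/forallP.
have -> : (fun h => if supp_ge m.+1 h then a h else 0) =
    (fun h => if supp_ge m h && (h (Ordinal md) == 0) then a h else 0).
  by apply/funext => h; rewrite supp_geS andbC.
rewrite /= -(@integral_lim_bsum_trig m md (supp_ge m) a b B abB).
apply: eq_Rintegral => t _.
transitivity (limn (bsum ^~ (fun h => if supp_ge m h then
    trig (a h) (b h) ((h (Ordinal md))%:~R * t) else 0))) => //.
(* For fixed outer variable t, the addition formula turns the inner integrand into a series of the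
   same form. Each new coefficient is bounded by the sum of the moduli of the two old ones, hence
   the doubled bound. *)
rewrite -(IH _ (fun h => trig (b h) (- a h) ((h (Ordinal md))%:~R * t)) (B + B)); first last.
- move=> K; apply: le_trans (lerD (abB K) (abB K)); rewrite -bsumD.
  apply: ler_bsum => h; apply: lerD; first exact: ler_norm_trig.
  by apply: le_trans (ler_norm_trig _ _ _) _; rewrite normrN addrC.
- exact: ltnW.
congr (iter_int m _); apply/funext => y; congr (limn _); apply/funext => K.
by apply: eq_bsum => h; rewrite pdotS trigD.
Qed.
End IteratedIntegral.

(** * Complex parts and character sums *)

Section ComplexParts.
Variable R : realType.

Lemma creD (x y : R[i]) : cre (x + y) = cre x + cre y.
Proof. by case: x y => [? ?] [? ?]. Qed.
Lemma cimD (x y : R[i]) : cim (x + y) = cim x + cim y.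
Proof. by case: x y => [? ?] [? ?]. Qed.
Lemma creB (x y : R[i]) : cre (x - y) = cre x - cre y.
Proof. by case: x y => [? ?] [? ?]. Qed.
Lemma cimB (x y : R[i]) : cim (x - y) = cim x - cim y.
Proof. by case: x y => [? ?] [? ?]. Qed.

Lemma cre_sum I (r : seq I) (P : pred I) (F : I -> R[i]) :
  cre (\sum_(i <- r | P i) F i) = \sum_(i <- r | P i) cre (F i).
Proof. by apply: (big_morph _ creD). Qed.

Lemma cim_sum I (r : seq I) (P : pred I) (F : I -> R[i]) :
  cim (\sum_(i <- r | P i) F i) = \sum_(i <- r | P i) cim (F i).
Proof. by apply: (big_morph _ cimD). Qed.

Lemma divr_natC (x : R[i]) p : x / p%:R = Complex (cre x / p%:R) (cim x / p%:R).
Proof.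
have -> : (p%:R : R[i])^-1 = ((p%:R)^-1)%:C%C.
  by rewrite fmorphV; congr _^-1; rewrite rmorph_nat.
by case: x => a b; congr Complex; rewrite /= ?mulr0 ?subr0 ?add0r.
Qed.

Lemma ler_cre_cabs (x : R[i]) : `|cre x| <= cabs x.
Proof. by rewrite -sqrtr_sqr ler_wsqrtr // lerDl sqr_ge0. Qed.
Lemma ler_cim_cabs (x : R[i]) : `|cim x| <= cabs x.
Proof. by rewrite -sqrtr_sqr ler_wsqrtr // lerDr sqr_ge0. Qed.

Lemma cabs_ge0 (x : R[i]) : 0 <= cabs x.
Proof. exact: sqrtr_ge0. Qed.

Lemma cabs_le (x : R[i]) : cabs x <= `|cre x| + `|cim x|.
Proof.
rewrite -[leRHS]ger0_norm ?addr_ge0 // -sqrtr_sqr ler_wsqrtr //.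
rewrite sqrrD !real_normK ?num_real // addrAC lerDl.
by rewrite mulrn_wge0 // mulr_ge0.
Qed.

Lemma cre_mul_expi (c : R[i]) t :
  cre (c * expi2pi t) = trig (cre c) (- cim c) t.
Proof. by case: c => a b; rewrite /trig mulNr. Qed.

Lemma cim_mul_expi (c : R[i]) t :
  cim (c * expi2pi t) = trig (cim c) (cre c) t.
Proof. by case: c => a b; rewrite /trig /= addrC. Qed.

Lemma expi2piD (s t : R) : expi2pi (s + t) = expi2pi s * expi2pi t.
Proof. by rewrite /expi2pi mulrDr cosD sinD; congr Complex; rewrite addrC. Qed.

Lemma expi2pi_int (k : int) : expi2pi (k%:~R : R) = 1.
Proof. by rewrite /expi2pi; have [-> ->] := cos_sin_2pi_int R k. Qed.

Lemma expi2pi_nat (t : R) k : expi2pi (k%:R * t) = expi2pi t ^+ k.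
Proof.
elim: k => [|k IH]; first by rewrite mul0r expr0 (expi2pi_int 0).
by rewrite -natr1 mulrDl mul1r expi2piD IH exprSr.
Qed.

Lemma expi2pi_neq1 (t : R) : 0 < t < 1 -> expi2pi t != 1.
Proof.
move=> /andP[t0 t1]; apply/eqP => -[c1 _].
have : cos (2 * pi * t) = 1 - sin (pi * t) ^+ 2 *+ 2.
  have -> : 2 * pi * t = (pi * t) *+ 2 by rewrite mulr2n; ring.
  by rewrite cos_mulr2n; have := cos2Dsin2 (pi * t); lra.
have : 0 < sin (pi * t).
  by rewrite sin_gt0_pi // mulr_gt0 ?pi_gt0 //= gtr_pMr ?pi_gt0.
rewrite c1 => s0; have := exprn_gt0 2 s0; lra.
Qed.

(** If p divides s, all terms are 1. Otherwise w = exp(2 pi i s/p) differs from 1, as seen after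
    reducing s modulo p, while w ^ p = 1, so the geometric sum vanishes. *)
Lemma sum_expi2pi p (s : int) : (0 < p)%N ->
  \sum_(k < p) expi2pi (k%:R * (s%:~R / p%:R) : R) =
  if (p%:Z %| s)%Z then p%:R else 0.
Proof.
move=> p0; have pR : 0 < p%:R :> R by rewrite ltr0n.
under eq_bigr => k _ do rewrite expi2pi_nat.
have E : expi2pi (s%:~R / p%:R : R) = expi2pi ((s %% p)%Z%:~R / p%:R).
  rewrite {1}(divz_eq s p%:Z) rmorphD rmorphM /= mulrDl mulfK ?gt_eqF //.
  by rewrite expi2piD expi2pi_int mul1r.
rewrite E; case: ifP => [/dvdz_mod0P ->|ps].
  under eq_bigr => k _ do rewrite mul0r (expi2pi_int 0) expr1n.
  by rewrite sumr_const card_ord.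
set w := expi2pi _.
have w1 : w - 1 != 0.
  rewrite subr_eq0; apply: expi2pi_neq1.
  have m0 : 0 < (s %% p)%Z.
    rewrite lt_def modz_ge0 ?andbT; last by lia.
    by apply: contraFN ps => /eqP H; apply/dvdz_mod0P.
  have mp : (s %% p)%Z < p%:Z by rewrite ltz_pmod.
  rewrite divr_gt0 ?ltr0z //= ltr_pdivrMr // mul1r.
  by rewrite -[ltRHS]/((p%:Z)%:~R) ltr_int.
apply: (mulfI w1); rewrite mulr0 -subrX1 /w -expi2pi_nat mulrC divfK ?gt_eqF //.
by rewrite expi2pi_int subrr.
Qed.

End ComplexParts.

(** * The error of a lattice rule as a sum of aliased coefficients *)

Section FourierLattice.
Variables (R : realType) (d : nat).
Local Open Scope classical_set_scope.
Local Open Scope ring_scope.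
Implicit Types (c : midx d -> R[i]) (h : midx d).

Lemma abs_summable_bsum c : abs_summable c ->
  exists B, forall K, bsum K (fun h => cabs (c h)) <= B.
Proof.
move=> sc; exists (fine (\esum_(h in [set: midx d]) (cabs (c h))%:E)) => K.
rewrite -lee_fin fineK; first by apply: bsum_le_esum => h; exact: cabs_ge0.
by rewrite ge0_fin_numE // esum_ge0 // => h _; rewrite lee_fin cabs_ge0.
Qed.

Lemma abs_summable_trig c B : (forall K, bsum K (fun h => cabs (c h)) <= B) ->
  forall K, bsum K (fun h => `|cre (c h)| + `|cim (c h)|) <= B + B.
Proof.
move=> cB K; apply: le_trans (lerD (cB K) (cB K)); rewrite -bsumD.
by apply: ler_bsum => h; rewrite lerD ?ler_cre_cabs ?ler_cim_cabs.
Qed.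

Lemma cre_fourier_fun c x : cre (fourier_fun c x) =
  limn (bsum ^~ (fun h => trig (cre (c h)) (- cim (c h)) (dotp h x))).
Proof.
congr (limn _); apply/funext => K; rewrite cre_sum.
by apply: eq_bigr => g _; exact: cre_mul_expi.
Qed.

Lemma cim_fourier_fun c x : cim (fourier_fun c x) =
  limn (bsum ^~ (fun h => trig (cim (c h)) (cre (c h)) (dotp h x))).
Proof.
congr (limn _); apply/funext => K; rewrite cim_sum.
by apply: eq_bigr => g _; exact: cim_mul_expi.
Qed.

Lemma pdot_dotp h (y : nat -> R) : dotp h (fun j => y (val j)) = pdot d h y.
Proof. by apply: eq_bigl => j; rewrite ltn_ord. Qed.

Lemma supp_ge_d h : supp_ge d h = (supp h == finset.set0).
Proof.
apply/forallP/eqP => [H|H j]; last first.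
  apply/implyP => _; have : j \notin supp h by rewrite H inE.
  by rewrite inE negbK.
apply/setP => j; rewrite !inE; apply/negbTE; rewrite negbK.
by have := H j; rewrite ltn_ord.
Qed.

Lemma iter_int_trig_full (a b : midx d -> R) B :
  (forall K, bsum K (fun h => `|a h| + `|b h|) <= B) ->
  iter_int d (fun y => limn (bsum ^~ (fun h =>
    trig (a h) (b h) (dotp h (fun j => y (val j)))))) = a [ffun=> 0].
Proof.
move=> abB; under [X in iter_int _ X]eq_fun do
  (under eq_fun do (under eq_fun do rewrite pdot_dotp)).
rewrite (iter_int_trig (leqnn d) abB).
under eq_fun do (under eq_fun do rewrite supp_ge_d).
under eq_fun do rewrite bsum_supp0.
by rewrite lim_cst.
Qed.

Lemma integral_cube_fourier c : abs_summable c ->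
  integral_cube (fourier_fun c) = c [ffun=> 0].
Proof.
move=> /abs_summable_bsum[B /abs_summable_trig cB]; rewrite /integral_cube.
under [X in Complex (iter_int _ X) _]eq_fun do rewrite cre_fourier_fun.
under [X in Complex _ (iter_int _ X)]eq_fun do rewrite cim_fourier_fun.
rewrite (@iter_int_trig_full _ _ (B + B)); last first.
  by move=> K; under eq_bsum do rewrite normrN; exact: cB.
rewrite (@iter_int_trig_full _ _ (B + B)); last first.
  by move=> K; under eq_bsum do rewrite addrC; exact: cB.
by case: (c _).
Qed.

(** Taking fractional parts changes the inner product by an integer, which the exponential
    ignores. *)
Lemma expi2pi_lattice_pt p z h k : (0 < p)%N ->
  expi2pi (dotp h (lattice_pt R p z k)) =
  expi2pi (k%:R * ((\sum_j h j * (z j)%:Z)%:~R / p%:R)).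
Proof.
move=> p0.
rewrite -[LHS]mul1r -(expi2pi_int R (\sum_j h j * Num.floor ((k * z j)%:R / p%:R : R))).
rewrite -expi2piD; congr expi2pi; rewrite /dotp /lattice_pt /fracR !rmorph_sum /=.
rewrite -big_split /= mulr_suml mulr_sumr; apply: eq_bigr => j _.
by rewrite !rmorphM /= -pmulrn; ring.
Qed.

Lemma sum_trig_lattice p z h (a b : R) : (0 < p)%N ->
  (\sum_(k < p) trig a b (dotp h (lattice_pt R p z k))) / p%:R =
  if dual_pt p z h then a else 0.
Proof.
move=> p0; have pR : p%:R != 0 :> R by rewrite pnatr_eq0 -lt0n.
have := sum_expi2pi R (\sum_j h j * (z j)%:Z) p0.
under eq_bigr => k _ do rewrite -expi2pi_lattice_pt //.
rewrite -/(dual_pt p z h) => E.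
have E1 := congr1 (@cre R) E; have E2 := congr1 (@cim R) E.
rewrite cre_sum in E1; rewrite cim_sum in E2.
rewrite /trig big_split /= -!mulr_sumr.
have -> : \sum_(i < p) cos (2 * pi * dotp h (lattice_pt R p z i)) =
  cre (if dual_pt p z h then p%:R else 0) by rewrite -E1.
have -> : \sum_(i < p) sin (2 * pi * dotp h (lattice_pt R p z i)) =
  cim (if dual_pt p z h then p%:R else 0) by rewrite -E2.
have -> : (p%:R : R[i]) = (p%:R : R)%:C%C by rewrite rmorph_nat.
by case: ifP => _ /=; rewrite ?mulr0 ?addr0 ?mulfK ?mul0r.
Qed.

Lemma lim_sum_trig_lattice p z (a b : midx d -> R) B : (0 < p)%N ->
  (forall K, bsum K (fun h => `|a h| + `|b h|) <= B) ->
  (\sum_(k < p) limn (bsum ^~ (fun h =>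
     trig (a h) (b h) (dotp h (lattice_pt R p z k))))) / p%:R =
  limn (bsum ^~ (fun h => if dual_pt p z h then a h else 0)).
Proof.
move=> p0 abB; apply/esym/cvg_lim => //.
under eq_fun do (under eq_bsum => h do rewrite -(sum_trig_lattice z h (a h) (b h) p0)).
have -> : (fun K => bsum K (fun h =>
    (\sum_(k < p) trig (a h) (b h) (dotp h (lattice_pt R p z k))) / p%:R)) =
    (fun K => (\sum_(k < p) bsum K (fun h =>
      trig (a h) (b h) (dotp h (lattice_pt R p z k)))) / p%:R).
  by apply/funext => K; rewrite /bsum -mulr_suml exchange_big.
apply: cvgMl; apply: cvg_big => [|k _]; first exact: add_continuous.
apply: (bsum_is_cvg (B := B)) => K.
apply: le_trans (abB K); apply: ler_bsum => h; exact: ler_norm_trig.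
Qed.

Lemma cre_lattice_rule c p z : (0 < p)%N -> abs_summable c ->
  cre (lattice_rule p z (fourier_fun c)) =
  limn (bsum ^~ (fun h => if dual_pt p z h then cre (c h) else 0)).
Proof.
move=> p0 /abs_summable_bsum[B /abs_summable_trig cB].
rewrite /lattice_rule divr_natC /= cre_sum.
under eq_bigr do rewrite cre_fourier_fun.
rewrite (@lim_sum_trig_lattice _ _ _ _ (B + B)) // => K.
by under eq_bsum do rewrite normrN; exact: cB.
Qed.

Lemma cim_lattice_rule c p z : (0 < p)%N -> abs_summable c ->
  cim (lattice_rule p z (fourier_fun c)) =
  limn (bsum ^~ (fun h => if dual_pt p z h then cim (c h) else 0)).
Proof.
move=> p0 /abs_summable_bsum[B /abs_summable_trig cB].
rewrite /lattice_rule divr_natC /= cim_sum.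
under eq_bigr do rewrite cim_fourier_fun.
rewrite (@lim_sum_trig_lattice _ _ _ _ (B + B)) // => K.
by under eq_bsum do rewrite addrC; exact: cB.
Qed.

(** With moduli of the coefficients, one quantity bounds the errors of both the real and the
    imaginary part. *)
Definition alias_error c p z : R :=
  limn (bsum ^~ (fun h =>
    if (supp h != finset.set0) && dual_pt p z h then cabs (c h) else 0)).

Lemma alias_error_cvg c p z : abs_summable c ->
  bsum ^~ (fun h => if (supp h != finset.set0) && dual_pt p z h then cabs (c h) else 0)
    @ \oo --> alias_error c p z.
Proof.
move=> /abs_summable_bsum[B cB]; apply: (bsum_is_cvg (B := B)) => K.
apply: le_trans (cB K); apply: ler_bsum => h.
by case: ifP; rewrite ?normr0 ?cabs_ge0 // ger0_norm ?cabs_ge0.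
Qed.

(** The zero frequency lies in every dual lattice and cancels against the subtracted term; only
    nonzero aliased frequencies remain. *)
Lemma lim_bsum_alias c (a : midx d -> R) p z : abs_summable c ->
  (forall h, `|a h| <= cabs (c h)) ->
  `|limn (bsum ^~ (fun h => if dual_pt p z h then a h else 0)) - a [ffun=> 0]|
    <= alias_error c p z.
Proof.
move=> sc ac; have [B cB] := abs_summable_bsum sc.
have E : limn (bsum ^~ (fun h => if dual_pt p z h then a h else 0)) - a [ffun=> 0] =
  limn (bsum ^~ (fun h => if (supp h != finset.set0) && dual_pt p z h then a h else 0)).
  have cv : cvgn (bsum ^~ (fun h => if dual_pt p z h then a h else 0)).
    apply: (bsum_is_cvg (B := B)) => K; apply: le_trans (cB K); apply: ler_bsum => h.
    by case: ifP => _; rewrite ?normr0 ?cabs_ge0.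
  apply/esym/cvg_lim => //.
  rewrite (_ : (fun K => _) = fun K =>
    bsum K (fun h => if dual_pt p z h then a h else 0) - a [ffun=> 0]).
    by apply: cvgB => //; exact: cvg_cst.
  apply/funext => K; rewrite -(bsum_supp0 K a) -bsumB; apply: eq_bsum => h.
  case: eqP => /= [h0|_]; last by rewrite subr0.
  suff -> : dual_pt p z h by rewrite subrr.
  rewrite /dual_pt big1 ?dvdz0 // => j _.
  have : j \notin supp h by rewrite h0 inE.
  by rewrite inE negbK => /eqP ->; rewrite mul0r.
rewrite E; have cv : cvgn (bsum ^~ (fun h =>
    if (supp h != finset.set0) && dual_pt p z h then a h else 0)).
  apply: (bsum_is_cvg (B := B)) => K; apply: le_trans (cB K); apply: ler_bsum => h.
  by case: ifP => _; rewrite ?normr0 ?cabs_ge0.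
rewrite -lim_norm //; apply: ler_lim; first exact: is_cvg_norm.
  by apply: cvgP; exact: alias_error_cvg.
apply: nearW => K; apply: le_trans (ler_norm_bsum _ _) _; apply: ler_bsum => h.
by case: ifP => _; rewrite ?normr0.
Qed.

Lemma cre_lattice_error c p z : (0 < p)%N -> abs_summable c ->
  `|cre (lattice_rule p z (fourier_fun c)) - cre (integral_cube (fourier_fun c))|
    <= alias_error c p z.
Proof.
move=> p0 sc; rewrite integral_cube_fourier // cre_lattice_rule //.
by apply: (lim_bsum_alias (a := fun h => cre (c h))) => // h; exact: ler_cre_cabs.
Qed.

Lemma cim_lattice_error c p z : (0 < p)%N -> abs_summable c ->
  `|cim (lattice_rule p z (fourier_fun c)) - cim (integral_cube (fourier_fun c))|
    <= alias_error c p z.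
Proof.
move=> p0 sc; rewrite integral_cube_fourier // cim_lattice_rule //.
by apply: (lim_bsum_alias (a := fun h => cim (c h))) => // h; exact: ler_cim_cabs.
Qed.

End FourierLattice.

(** * Medians and independent draws *)

Section Median.
Variable R : realType.

(** If the median is at least a, all entries from the middle of the sorted list upwards are at least
    as far from a; otherwise all entries up to the middle are. Either half has m + 1 entries. *)
Lemma median_count (s : seq R) (a : R) m : size s = m.*2.+1 ->
  (m < count (fun x : R => (`|median s - a| <= `|x - a|)%R) s)%N.
Proof.
move=> sz; rewrite -(count_sort <=%R) /median sz.
have -> : (m.*2.+1./2)%N = m by rewrite -[m.*2.+1]/((true + m.*2)%N) half_bit_double.
set t := sort _ s; have st : size t = m.*2.+1 by rewrite size_sort.
have tle i j : (i <= j)%N -> (j < size t)%N -> nth 0 t i <= nth 0 t j.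
  move=> ij jt; apply: (sorted_leq_nth le_trans lexx 0 (sort_sorted le_total s)) => //.
  by rewrite inE (leq_ltn_trans ij).
set v := nth 0 t m; set P := fun x : R => _.
case: (leP a v) => av.
  rewrite -(cat_take_drop m t) count_cat; apply: ltn_addl.
  rewrite (_ : count P (drop m t) = size (drop m t)); first by rewrite size_drop st; lia.
  apply/eqP; rewrite -all_count; apply/(all_nthP 0) => i; rewrite size_drop st => im.
  rewrite nth_drop /P; have := tle m (m + i)%N (leq_addr _ _); rewrite st => H.
  have {}H : v <= nth 0 t (m + i) by apply: H; lia.
  by rewrite !ger0_norm; lra.
rewrite -(cat_take_drop m.+1 t) count_cat; apply: ltn_addr.
rewrite (_ : count P (take m.+1 t) = size (take m.+1 t)).
  by rewrite size_takel // st; lia.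
apply/eqP; rewrite -all_count; apply/(all_nthP 0) => i.
rewrite size_takel ?st => [im|]; last by lia.
rewrite nth_take // /P; have := tle i m im; rewrite st => H.
have {}H : nth 0 t i <= v by apply: H; lia.
by rewrite !ler0_norm; lra.
Qed.

Lemma median_card m (f : 'I_(m.*2.+1) -> R) (a : R) :
  (m < #|[set k | (`|median [seq f k | k <- enum 'I_(m.*2.+1)] - a| <= `|f k - a|)%R]|)%N.
Proof.
have := @median_count [seq f k | k <- enum 'I_(m.*2.+1)] a m.
rewrite size_map size_enum_ord => /(_ erefl); rewrite count_map.
rewrite -size_filter; set D := finset _; move/leq_trans; apply.
have -> : #|D| = size [seq k <- enum 'I_(m.*2.+1) | k \in D] by rewrite cardE enumT.
by apply: eq_leq; congr size; apply: eq_filter => k; rewrite /D inE.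
Qed.

Variables (m : nat) (f : 'I_(m.*2.+1) -> R) (a : R) (bad : {set 'I_(m.*2.+1)}).

Let v := `|median [seq f k | k <- enum 'I_(m.*2.+1)] - a|.

Lemma median_le_max t : (#|bad| <= m)%N ->
  (forall k, k \notin bad -> `|f k - a| <= t) -> v <= t.
Proof.
move=> bm ft; have := median_card f a; rewrite -/v; set D := [set k | _] => mD.
have : ~~ (D \subset bad).
  by apply: contraTN mD => /subset_leq_card H; rewrite -leqNgt (leq_trans H).
case/fintype.subsetPn => k; rewrite inE => vk kb.
exact: le_trans vk (ft k kb).
Qed.

Variable X : 'I_(m.*2.+1) -> R.
Hypothesis fX : forall k, `|f k - a| <= X k.

(* At least [m.+1] draws are no closer to [a] than the median is, and at least half of
   these are not bad. *)
Lemma median_le_mean : (#|bad|.*2 <= m)%N ->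
  v <= 2 / m.+1%:R * \sum_(k | k \notin bad) X k.
Proof.
move=> bm; have := median_card f a; rewrite -/v; set D := [set k | _] => mD.
have X0 k : 0 <= X k by apply: le_trans (fX k).
have v0 : 0 <= v by rewrite normr_ge0.
have H : (m.+1 <= #|D :\: bad|.*2)%N.
  have sb : (#|D :&: bad| <= #|bad|)%N by rewrite subset_leq_card // finset.subsetIr.
  by rewrite cardsD; move: #|D| #|bad| #|D :&: bad| bm mD sb => x y z; clear; lia.
rewrite mulrAC ler_pdivlMr ?ltr0n //.
apply: le_trans (_ : v * (#|D :\: bad|.*2)%:R <= _); first by rewrite ler_wpM2l // ler_nat.
rewrite -mul2n natrM mulrCA ler_wpM2l //.
apply: le_trans (_ : \sum_(k in D :\: bad) X k <= _).
  rewrite mulr_natr -sumr_const; apply: ler_sum => k; rewrite !inE => /andP[_ vk].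
  exact: le_trans vk (fX k).
rewrite [leRHS](bigID (mem D)) /= -[leLHS]addr0 lerD ?sumr_ge0 //.
by rewrite le_eqVlt; apply/orP; left; apply/eqP; apply: eq_bigl => k; rewrite !inE.
Qed.

End Median.

(** * Independent draws *)

Section ProductMeasure.
Variables (R : realType) (T : finType) (mu : T -> R) (N : nat).
Hypotheses (mu0 : forall t, 0 <= mu t) (mu1 : \sum_t mu t = 1).

Lemma sum_prod_prob : \sum_(w : {ffun 'I_N -> T}) \prod_k mu (w k) = 1.
Proof.
rewrite -(bigA_distr_bigA (fun=> mu)) /=.
by under eq_bigr => k _ do rewrite mu1; rewrite big1.
Qed.

Lemma sum_prod_prob_coord (X : T -> R) (k : 'I_N) :
  \sum_(w : {ffun 'I_N -> T}) (\prod_j mu (w j)) * X (w k) = \sum_t mu t * X t.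
Proof.
transitivity (\prod_(j < N) \sum_t (mu t * (if j == k then X t else 1))).
  rewrite bigA_distr_bigA /=; apply: eq_bigr => w _; rewrite big_split /=.
  by congr (_ * _); rewrite -big_mkcond big_pred1_eq.
rewrite (bigD1 k) //= eqxx [X in _ * X]big1 ?mulr1 // => j /negPf ->.
by under eq_bigr do rewrite mulr1.
Qed.

Lemma sum_prod_prob_sum (X : T -> R) :
  \sum_(w : {ffun 'I_N -> T}) (\prod_j mu (w j)) * \sum_k X (w k) =
  N%:R * \sum_t mu t * X t.
Proof.
under eq_bigr do rewrite mulr_sumr.
rewrite exchange_big /=; under eq_bigr do rewrite sum_prod_prob_coord.
by rewrite sumr_const card_ord -[LHS]mulr_natl.
Qed.

(* Markov's inequality for [q^-1] to the power of the number of bad draws. *)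
Lemma prob_many_bad (bad : pred T) (q : R) (n : nat) : 0 < q <= 1 ->
  \sum_(t | bad t) mu t <= q ->
  \sum_(w : {ffun 'I_N -> T} | (n <= #|[set k | bad (w k)]|)%N) \prod_k mu (w k)
    <= 2 ^+ N * q ^+ n.
Proof.
move=> /andP[q0 q1] bq; pose c t := if bad t then q^-1 else 1.
have c0 t : 0 <= c t by rewrite /c; case: ifP => _ //; rewrite invr_ge0 ltW.
apply: le_trans (_ : \sum_(w : {ffun 'I_N -> T}) q ^+ n * \prod_k (mu (w k) * c (w k)) <= _).
  rewrite [leRHS](bigID (fun w : {ffun 'I_N -> T} => (n <= #|[set k | bad (w k)]|)%N)) /=.
  rewrite -[leLHS]addr0 lerD //; last first.
    apply: sumr_ge0 => w _; rewrite mulr_ge0 ?exprn_ge0 ?(ltW q0) //.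
    by apply: prodr_ge0 => k _; rewrite mulr_ge0.
  apply: ler_sum => w nw; rewrite big_split /= mulrCA ler_peMr ?prodr_ge0 //.
  rewrite -big_mkcond /= prodr_const (_ : #|_| = #|[set k | bad (w k)]|); last first.
    by apply: eq_card => k; rewrite !inE.
  rewrite exprVn ler_pdivlMr ?exprn_gt0 // mul1r ler_wiXn2l // ltW //.
rewrite -mulr_sumr mulrC ler_wpM2r ?exprn_ge0 ?(ltW q0) //.
rewrite -(bigA_distr_bigA (fun=> (fun t => mu t * c t))) /= prodr_const card_ord.
rewrite lerXn2r ?nnegrE ?sumr_ge0 // => [t _|]; first by rewrite mulr_ge0.
(* The expectation factors over the draws. In each factor the bad values contribute at most q / q =
   1, the others at most the total mass 1. *)
rewrite (bigID bad) /= -[2]/(1 + 1) lerD //.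
  rewrite (eq_bigr (fun t => mu t * q^-1)) => [|t bt]; last by rewrite /c bt.
  by rewrite -mulr_suml ler_pdivrMr // mul1r.
rewrite -mu1 [leRHS](bigID bad) /= -[leLHS]add0r lerD ?sumr_ge0 //.
by apply: ler_sum => t /negPf bt; rewrite /c bt mulr1.
Qed.

End ProductMeasure.

(** * Summability of the weights *)

Section ZetaBound.
Variable R : realType.

(** A discrete integral comparison. Divided by (n + 2) ^ (- delta) it becomes 1 + delta/(n + 2) <=
    ((n + 1)/(n + 2)) ^ (- delta), which follows from 1 + x <= exp x and ln (1 + x) <= x. *)
Lemma powR_telescope (delta : R) n : 0 < delta ->
  delta * n.+2%:R `^ (- (1 + delta)) <= n.+1%:R `^ (- delta) - n.+2%:R `^ (- delta).
Proof.
move=> d0; have n1 : 0 < n.+1%:R :> R by rewrite ltr0n.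
have n2 : 0 < n.+2%:R :> R by rewrite ltr0n.
have p0 : 0 < (n.+2%:R : R) `^ (- delta) by rewrite powR_gt0.
have -> : (n.+2%:R : R) `^ (- (1 + delta)) = n.+2%:R `^ (- delta) / n.+2%:R.
  rewrite opprD addrC powRD; last by rewrite (gt_eqF n2) implybT.
  by rewrite powR_inv1 // ltW.
suff : n.+2%:R `^ (- delta) * (1 + delta / n.+2%:R) <= n.+1%:R `^ (- delta) :> R.
  move: (n.+2%:R `^ (- delta)) => p.
  by rewrite mulrDr mulr1 [p * (_ / _)]mulrCA lerBrDl.
have -> : (n.+1%:R : R) `^ (- delta) =
    n.+2%:R `^ (- delta) * (n.+1%:R / n.+2%:R) `^ (- delta).
  rewrite -powRM ?ltW ?divr_gt0 //; congr (_ `^ _).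
  by rewrite mulrC divfK ?gt_eqF.
rewrite ler_pM2l //.
have q0 : 0 < n.+1%:R / n.+2%:R :> R by rewrite divr_gt0.
rewrite /powR gt_eqF //.
apply: le_trans (expR_ge1Dx _) _; rewrite ler_expR mulNr -mulrN ler_pM2l //.
have E : 1 + - (n.+2%:R)^-1 = n.+1%:R / n.+2%:R :> R.
  have -> : n.+1%:R = n.+2%:R - 1 :> R by rewrite -[n.+2%:R]natr1 addrK.
  by rewrite mulrBl mulfV ?gt_eqF // mul1r.
have : (n.+2%:R)^-1 < 1 :> R by rewrite invf_lt1 // ltr1n.
have := @le_ln1Dx R (- n.+2%:R^-1); rewrite E => H n21.
by rewrite lerNr; apply: H; rewrite ltrN2.
Qed.

Lemma sum_zeta_le (delta : R) K : 0 < delta ->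
  \sum_(k < K) k.+1%:R `^ (- (1 + delta)) <= 1 + delta^-1.
Proof.
move=> d0; case: K => [|K]; first by rewrite big_ord0 addr_ge0 // invr_ge0 ltW.
suff H : delta * \sum_(k < K.+1) k.+1%:R `^ (- (1 + delta)) <=
    delta + (1 - K.+1%:R `^ (- delta)).
  rewrite -(ler_pM2l d0) mulrDr mulr1 mulfV ?gt_eqF //.
  by apply: (le_trans H); rewrite lerD2l gerBl powR_ge0.
elim: K => [|K IH]; first by rewrite big_ord1 !powR1 mulr1 subrr addr0.
rewrite big_ord_recr /= mulrDr; have := powR_telescope K d0; lra.
Qed.

Lemma sum_box_even (F : int -> R) K : (forall k, F (- k) = F k) ->
  \sum_(i < K.*2.+1) F (i%:Z - K%:Z) = F 0 + 2 * \sum_(k < K) F (k.+1%:Z).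
Proof.
move=> Fe; elim: K => [|K IH]; first by rewrite big_ord1 big_ord0 mulr0 !addr0.
rewrite doubleS big_ord_recl big_ord_recr /= [in RHS]big_ord_recr /=.
have -> : \sum_(i < K.*2.+1) F ((bump 0 i)%:Z - K.+1%:Z) = \sum_(i < K.*2.+1) F (i%:Z - K%:Z).
  by apply: eq_bigr => i _; congr F; rewrite /bump /=; lia.
rewrite IH sub0r Fe.
have -> : (bump 0 K.*2.+1)%:Z - K.+1%:Z = K.+1%:Z by rewrite /bump /=; lia.
ring.
Qed.

End ZetaBound.

Section Weights.
Variables (R : realType) (d : nat) (alpha : R) (gamma : nat -> R).
Hypothesis (a0 : 0 < alpha) (g01 : forall j, 0 < gamma j <= 1).

Definition rho (h : midx d) : R := (rweight alpha (@prod_weight R gamma d) h)^-1.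

Lemma rhoE h : rho h = \prod_(j in supp h) (gamma (val j) * (`|h j|%:~R : R) `^ (- alpha)).
Proof.
rewrite /rho /rweight /prod_weight invfM invrK big_split /=; congr (_ * _).
by rewrite -prodfV; apply: eq_bigr => j _; rewrite powRN.
Qed.

Lemma rho_gt0 h : 0 < rho h.
Proof.
rewrite rhoE prodr_gt0 // => j js; have /andP[g0 _] := g01 (val j).
by rewrite mulr_gt0 // powR_gt0 // (lt_le_trans ltr01) // supp_ge1.
Qed.

Lemma rho_le1 h : rho h <= 1.
Proof.
rewrite rhoE; suff : 0 <= \prod_(j in supp h)
  (gamma (val j) * (`|h j|%:~R : R) `^ (- alpha)) <= 1 by case/andP.
apply: (big_ind (fun x => 0 <= x <= 1)) => [|x y /andP[x0 x1] /andP[y0 y1]|j js].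
- by rewrite ler01 lexx.
- by rewrite mulr_ge0 // mulr_ile1.
have /andP[g0 g1] := g01 (val j).
rewrite mulr_ge0 ?powR_ge0 ?(ltW g0) //= mulr_ile1 ?powR_ge0 ?(ltW g0) //.
have := ler_powR (supp_ge1 R js) (_ : - alpha <= 0); rewrite powRr0; apply.
by rewrite oppr_le0 ltW.
Qed.

Lemma powR_prod (I : finType) (P : pred I) (F : I -> R) b : (forall i, 0 <= F i) ->
  (\prod_(i | P i) F i) `^ b = \prod_(i | P i) F i `^ b.
Proof.
move=> F0; suff [] : 0 <= \prod_(i | P i) F i /\
  (\prod_(i | P i) F i) `^ b = \prod_(i | P i) F i `^ b by [].
apply: (big_ind2 (fun x y => 0 <= x /\ x `^ b = y)) => [|x x' y y' [x0 <-] [y0 <-]|i _].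
- by rewrite powR1.
- by rewrite mulr_ge0 // powRM.
- by [].
Qed.

(** The sum is a product over coordinates. The squared [freq_pow] costs 2 [delta] of the exponent 1
    + 3 [delta], so each one-dimensional sum converges; as [beta] exceeds 1/[alpha], each factor is
    at most 1 + x <= exp x with x a multiple of [gamma j] to the power 1/[alpha]. The dimension
    enters only through G. *)
Lemma bsum_weight_le (beta delta G : R) K : 0 < delta ->
  alpha * beta = 1 + 3 * delta ->
  \sum_(j < d) gamma j `^ (alpha^-1) <= G ->
  bsum K (fun h => rho h `^ beta * freq_pow delta h ^+ 2)
    <= expR (2 * (1 + delta^-1) * G).
Proof.
move=> d0 ab gG.
have b0 : 0 < beta by rewrite -(pmulr_rgt0 _ a0) ab; lra.
pose phi (j : 'I_d) (k : int) : R :=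
  if k == 0 then 1 else gamma j `^ beta * (`|k|%:~R) `^ (- (1 + delta)).
have -> : bsum K (fun h => rho h `^ beta * freq_pow delta h ^+ 2) =
    bsum K (fun h => \prod_j phi j (h j)).
  apply: eq_bsum => h; rewrite rhoE /freq_pow -prodrXl powR_prod; last first.
    by move=> j; rewrite mulr_ge0 ?powR_ge0 //; have /andP[/ltW] := g01 (val j).
  rewrite -big_split big_mkcond /=; apply: eq_bigr => j _; rewrite /phi.
  case: ifP => js; last by move: js; rewrite inE => /negbFE ->.
  have := js; rewrite inE => /negPf ->.
  have x1 := supp_ge1 R js; set x := _%:~R in x1 *.
  have x0 : 0 < x by exact: lt_le_trans x1.
  have /andP[g0 _] := g01 (val j).
  rewrite powRM ?powR_ge0 ?(ltW g0) // -powRrM -mulrA; congr (_ * _).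
  rewrite -powR_mulrn ?powR_ge0 // -powRrM -powRD; last by rewrite (gt_eqF x0) implybT.
  by congr (_ `^ _); rewrite mulNr ab; ring.
rewrite bsum_prod.
apply: le_trans (_ : \prod_(j < d) expR (2 * (1 + delta^-1) * gamma j `^ alpha^-1) <= _).
  apply: ler_prod => j _; have /andP[g0 g1] := g01 j.
  have phi0 k : 0 <= phi j k by rewrite /phi; case: ifP => // _; rewrite mulr_ge0 ?powR_ge0.
  rewrite sumr_ge0 //= sum_box_even; last by move=> k; rewrite /phi oppr_eq0 normrN.
  rewrite {1}/phi eqxx; under eq_bigr do rewrite /phi /=.
  rewrite -mulr_sumr; apply: le_trans (expR_ge1Dx _); rewrite lerD2l -!mulrA ler_wpM2l //.
  rewrite mulrC; apply: ler_pM; first by apply: sumr_ge0 => k _; exact: powR_ge0.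
  - exact: powR_ge0.
  - by apply: le_trans (sum_zeta_le K d0); apply: ler_sum => k _; rewrite ger0_norm.
  - apply: ger_powR; first by rewrite g0.
    rewrite -[leLHS]mul1r ler_pdivrMr // mulrC ab; lra.
rewrite -expR_sum ler_expR -mulr_sumr ler_wpM2l //.
by rewrite mulr_ge0 // addr_ge0 // invr_ge0 ltW.
Qed.

End Weights.

(** * Aliasing errors of good draws *)

Lemma powR_sqr (R : realType) (x b : R) : (x `^ b) ^+ 2 = x `^ (b * 2).
Proof. by rewrite powRrM powR_mulrn ?powR_ge0. Qed.

Lemma bsum_term (R : realType) d (h : midx d) :
  exists K, forall F : midx d -> R, (forall h', 0 <= F h') -> F h <= bsum K F.
Proof.
pose K := \max_j `|h j|%N; exists K => F F0.
have hK : h \in box_seq d K.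
  by rewrite mem_box_seq; apply/forallP => j; rewrite /K (leq_bigmax j).
by rewrite bsum_seq (big_rem _ hK) /= lerDl sumr_ge0.
Qed.

(** The Cauchy-Schwarz inequality, obtained by summing x y <= v x^2 / 2 + y^2 / (2 v). *)
Lemma bsum_AMGM (R : realType) d K (x y : midx d -> R) v : 0 < v ->
  bsum K (fun h => x h ^+ 2) <= 1 -> bsum K (fun h => y h ^+ 2) <= v ^+ 2 ->
  bsum K (fun h => x h * y h) <= v.
Proof.
move=> v0 x1 yv.
apply: le_trans (_ : bsum K (fun h => v / 2 * x h ^+ 2 + (2 * v)^-1 * y h ^+ 2) <= _).
  apply: ler_bsum => h; rewrite -subr_ge0.
  have -> : v / 2 * x h ^+ 2 + (2 * v)^-1 * y h ^+ 2 - x h * y h =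
     (2 * v)^-1 * (v * x h - y h) ^+ 2 by field; rewrite gt_eqF.
  by rewrite mulr_ge0 ?sqr_ge0 // invr_ge0 mulr_ge0 // ltW.
rewrite bsumD !bsumZ; have vi : 0 < (2 * v)^-1 by rewrite invr_gt0 mulr_gt0.
have : (2 * v)^-1 * bsum K (fun h => y h ^+ 2) <= v / 2.
  apply: le_trans (ler_wpM2l (ltW vi) yv) _.
  by rewrite le_eqVlt; apply/orP; left; apply/eqP; field; rewrite gt_eqF.
have : v / 2 * bsum K (fun h => x h ^+ 2) <= v / 2.
  by rewrite ler_piMr // divr_ge0 // ltW.
by lra.
Qed.

Lemma korobov_ball_bsum (R : realType) d alpha gu (c : midx d -> R[i]) K :
  korobov_ball alpha gu c ->
  bsum K (fun h => (rweight alpha gu h * cabs (c h)) ^+ 2) <= 1.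
Proof.
move=> [_]; rewrite /korobov_norm.
have := @bsum_le_esum R d K (fun h => (rweight alpha gu h) ^+ 2 * (cabs (c h)) ^+ 2).
move=> /(_ (fun h => mulr_ge0 (sqr_ge0 _) (sqr_ge0 _))).
case: (esum _ _) => [r| |//]; last by rewrite leye_eq.
rewrite !lee_fin => br sr; apply: le_trans (_ : r <= _).
  by apply: le_trans br; apply: ler_bsum => h; rewrite exprMn.
have [r0|r0] := leP 0 r; last by rewrite (le_trans (ltW r0)).
by rewrite -(sqr_sqrtr r0) expr_le1 // sqrtr_ge0.
Qed.

Section Aliasing.
Variables (R : realType) (alpha beta delta A K q : R) (gamma : nat -> R) (d n : nat).
Hypotheses (alpha0 : 0 < alpha) (gamma01 : forall j, 0 < gamma j <= 1).
Hypotheses (beta0 : 0 < beta) (beta2 : beta <= 2) (delta0 : 0 < delta).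
Hypotheses (A0 : 0 < A) (K0 : 0 < K) (q0 : 0 < q) (n1 : (1 < n)%N).
Let W := @freq_pow R d delta.
Let rh := @rho R d alpha gamma.
Let mu := @draw_prob d n R.
Hypothesis weightA : forall B, bsum B (fun h => rh h `^ beta * W h ^+ 2) <= A.
Hypothesis dualK : forall h : midx d, supp h != finset.set0 ->
  \sum_(t : draw d n | in_dual t h) mu t <= K * W h * n%:R `^ (delta - 1).

Definition aliased (t : draw d n) (h : midx d) : bool :=
  (supp h != finset.set0) && in_dual t h.

Let nd : R := n%:R `^ (delta - 1).

(* Chosen so that Markov's inequality bounds the probability of a bad draw by [q]. *)
Definition threshold : R := K * A / q * n%:R `^ (delta - 1).

Let T := threshold.

(* Outcomes of probability zero (possibly with p = 0) also count as bad. *)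
Definition bad_draw (t : draw d n) : bool :=
  ~~ draw_ok t ||
  `[< exists B, T < bsum B (fun h => if aliased t h then rh h `^ beta else 0) >].

Lemma nd_gt0 : 0 < nd. Proof. by rewrite powR_gt0 // ltr0n ltnW. Qed.

Lemma threshold_gt0 : 0 < T.
Proof. by rewrite mulr_gt0 ?nd_gt0 // !mulr_gt0 // invr_gt0. Qed.

Let rh0 h : 0 < rh h. Proof. exact: rho_gt0. Qed.
Let rh1 h : rh h <= 1. Proof. exact: rho_le1. Qed.
Let rhb0 h : 0 < rh h `^ beta. Proof. exact: powR_gt0. Qed.
Let W1 h : 1 <= W h. Proof. by apply: freq_pow_ge1; exact: ltW. Qed.

(** The expectation is taken frequency by frequency, and [dualK] bounds each aliasing
    probability. *)
Lemma sum_aliased_le B (F : midx d -> R) : (forall h, 0 <= F h) ->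
  \sum_t mu t * bsum B (fun h => if aliased t h then F h else 0) <=
  K * nd * bsum B (fun h => F h * W h).
Proof.
move=> F0; rewrite /bsum; under eq_bigr do rewrite mulr_sumr.
rewrite exchange_big mulr_sumr /=; apply: ler_sum => g _; set h := box_idx g.
have [s0|s0] := eqVneq (supp h) finset.set0.
  rewrite big1 => [|t _]; last by rewrite /aliased s0 eqxx mulr0.
  by rewrite !mulr_ge0 ?(ltW nd_gt0) ?(ltW K0) // (le_trans ler01).
apply: le_trans (_ : F h * \sum_(t | in_dual t h) mu t <= _).
  rewrite mulr_sumr [leRHS]big_mkcond; apply: ler_sum => t _.
  by rewrite /aliased s0 /=; case: ifP => _; rewrite ?mulr0 // mulrC.
have -> : K * nd * (F h * W h) = F h * (K * W h * nd) by ring.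
by rewrite ler_wpM2l // dualK.
Qed.

Lemma prob_bad_draw : \sum_(t | bad_draw t) mu t <= q.
Proof.
have T0 := threshold_gt0.
pose S t B := bsum B (fun h => if aliased t h then rh h `^ beta else 0).
have /choice[f fP] : forall t, exists B, bad_draw t -> draw_ok t -> T < S t B.
  move=> t; case: (pselect (exists B, T < S t B)) => [[B TB]|nB]; first by exists B.
  exists 0%N => /orP[/negPf -> //|/asboolP eB]; by case: nB.
(* There are finitely many draws, so one box exhibits all bad ones and Markov's inequality is
   applied to a finite sum. *)
pose B := \max_t f t.
rewrite -(ler_pM2l T0).
apply: le_trans (_ : \sum_t mu t * S t B <= _).
  rewrite mulr_sumr big_mkcond; apply: ler_sum => t _.
  have S0 : 0 <= S t B by apply: bsum_ge0 => h; case: ifP => // _; exact: ltW.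
  case: ifP => [bt|_]; last by rewrite mulr_ge0 // draw_prob_ge0.
  rewrite mulrC; case: (boolP (draw_ok t)) => [okt|/negPf nok]; last first.
    by rewrite /mu /draw_prob nok !mul0r.
  rewrite ler_wpM2l ?draw_prob_ge0 //; apply: le_trans (ltW (fP t bt okt)) _.
  apply: (bsum_nondecreasing (F := fun h => if aliased t h then rh h `^ beta else 0)).
    by move=> h; case: ifP => // _; exact: ltW.
  exact: leq_bigmax.
apply: le_trans (sum_aliased_le B (fun h => ltW (rhb0 h))) _.
apply: le_trans (_ : K * nd * A <= _).
  rewrite ler_wpM2l ?mulr_ge0 ?(ltW nd_gt0) ?(ltW K0) //.
  apply: le_trans (weightA B); apply: ler_bsum => h.
  rewrite ler_wpM2l ?(ltW (rhb0 h)) // expr2 ler_peMl //.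
  exact: le_trans ler01 (W1 h).
rewrite le_eqVlt; apply/orP; left; apply/eqP; rewrite /T /threshold -/nd; field.
by rewrite gt_eqF.
Qed.

Lemma good_draw_bsum t B : ~~ bad_draw t ->
  bsum B (fun h => if aliased t h then rh h `^ beta else 0) <= T.
Proof.
rewrite negb_or => /andP[_ /asboolPn nB]; rewrite leNgt; apply/negP => TB.
by apply: nB; exists B.
Qed.

Lemma good_draw_aliased t h : ~~ bad_draw t -> aliased t h -> rh h `^ beta <= T.
Proof.
move=> gt th; have [B HB] := bsum_term R h.
have := HB (fun h => if aliased t h then rh h `^ beta else 0); rewrite th => /(_ _)/le_trans; apply.
  by move=> h'; case: ifP => // _; exact: ltW.
exact: good_draw_bsum.
Qed.

(** Here rho^2 = rho^beta rho^(2 - beta), and the last factor is a nonnegative power of rho^beta <=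
    T because [beta] is at most 2. *)
Lemma rho_sqr_le h : rh h `^ beta <= T ->
  rh h ^+ 2 <= rh h `^ beta * (T `^ (beta^-1 - 2^-1)) ^+ 2.
Proof.
move=> hT; have -> : rh h ^+ 2 = rh h `^ beta * ((rh h `^ beta) `^ (beta^-1 - 2^-1)) ^+ 2.
  rewrite powR_sqr -powRrM -powRD; last by rewrite (gt_eqF (rh0 h)) implybT.
  rewrite -(powR_mulrn _ (ltW (rh0 h))).
  by congr (_ `^ _); field; rewrite gt_eqF.
rewrite ler_wpM2l ?(ltW (rhb0 h)) // lerXn2r ?nnegrE ?powR_ge0 //.
apply: ge0_ler_powR; rewrite ?nnegrE ?(ltW (rhb0 h)) ?(ltW threshold_gt0) //.
by rewrite subr_ge0 lef_pV2 // posrE.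
Qed.

Variable c : midx d -> R[i].
Hypothesis cball : korobov_ball alpha (@prod_weight R gamma d) c.

Let cweight h := rweight alpha (@prod_weight R gamma d) h * cabs (c h).

Lemma cweightE h : cabs (c h) = cweight h * rh h.
Proof. by rewrite /cweight /rh /rho mulrAC mulfV ?mul1r // -invr_eq0 gt_eqF // rh0. Qed.

(** Cauchy-Schwarz against the Korobov norm. The factor F is 1 in the worst-case bounds and
    [freq_pow] in the mean. *)
Lemma bsum_coef_le B (P : pred (midx d)) (F : midx d -> R) v : 0 < v ->
  bsum B (fun h => if P h then (rh h * F h) ^+ 2 else 0) <= v ^+ 2 ->
  bsum B (fun h => if P h then cabs (c h) * F h else 0) <= v.
Proof.
move=> v0 Hv.
have := @bsum_AMGM R d B cweight (fun h => if P h then rh h * F h else 0) v v0.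
move=> /(_ (korobov_ball_bsum B cball)).
have E h : (if P h then rh h * F h else 0) ^+ 2 = if P h then (rh h * F h) ^+ 2 else 0.
  by case: ifP => // _; rewrite expr0n.
rewrite (eq_bsum B E) => /(_ Hv); congr (_ <= _); apply: eq_bsum => h.
by case: ifP => _; rewrite ?mulr0 // mulrA -cweightE.
Qed.

Let alias (t : draw d n) := alias_error c (t.1 : nat) (fun j => (t.2 j : nat)).

Let cvg_alias t : (bsum ^~ (fun h => if aliased t h then cabs (c h) else 0)
    @ \oo --> alias t)%classic.
Proof. by apply: alias_error_cvg; case: cball. Qed.

Lemma alias_ge0 t : 0 <= alias t.
Proof.
rewrite -(cvg_lim _ (@cvg_alias t)) //; apply: limr_ge; first by apply: cvgP; exact: cvg_alias.
by apply: nearW => B; apply: bsum_ge0 => h; case: ifP => _ //; exact: cabs_ge0.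
Qed.

Lemma alias_le (b : R) t :
  (forall B, bsum B (fun h => if aliased t h then cabs (c h) else 0) <= b) ->
  alias t <= b.
Proof.
move=> H; rewrite -(cvg_lim _ (@cvg_alias t)) //.
apply: limr_le; first by apply: cvgP; exact: cvg_alias.
exact: nearW.
Qed.

(** A crude bound valid for bad draws as well; it serves the rare event that many draws are bad. *)
Lemma alias_le_max t : alias t <= Num.sqrt A.
Proof.
apply: alias_le => B.
under eq_bsum => h do rewrite -[cabs _]mulr1.
apply: bsum_coef_le; first by rewrite sqrtr_gt0.
rewrite sqr_sqrtr ?(ltW A0) //; apply: le_trans (weightA B).
apply: ler_bsum => h; case: ifP => _; last by rewrite mulr_ge0 ?(ltW (rhb0 h)) // sqr_ge0.
rewrite mulr1 -[leLHS]mulr1; apply: ler_pM => //; first exact: sqr_ge0.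
  rewrite -powR_mulrn ?(ltW (rh0 h)) //; apply: ger_powR => //.
  by rewrite rh0 rh1.
by rewrite expr_ge1 // (le_trans ler01).
Qed.

(** Goodness is used twice: each aliased frequency satisfies [rho_sqr_le], and the remaining sum of
    rho^beta is at most T. *)
Lemma good_alias_le t : ~~ bad_draw t -> alias t <= T `^ beta^-1.
Proof.
move=> gt; apply: alias_le => B.
under eq_bsum => h do rewrite -[cabs _]mulr1.
apply: bsum_coef_le; first by rewrite powR_gt0 ?threshold_gt0.
have -> : (T `^ beta^-1) ^+ 2 = (T `^ (beta^-1 - 2^-1)) ^+ 2 * T.
  rewrite !powR_sqr -[X in _ = _ * X]powRr1 ?(ltW threshold_gt0) //.
  rewrite -powRD; last by rewrite (gt_eqF threshold_gt0) implybT.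
  by congr (_ `^ _); field; rewrite gt_eqF.
apply: le_trans (ler_wpM2l (sqr_ge0 _) (good_draw_bsum B gt)).
rewrite -bsumZ; apply: ler_bsum => h; case: ifP => th; last by rewrite mulr0.
by rewrite mulr1 mulrC; apply: rho_sqr_le; exact: good_draw_aliased gt th.
Qed.

(* The first-moment bound gains from good draws only seeing frequencies of large weight. *)
Lemma mean_good_alias_le :
  \sum_t mu t * (if bad_draw t then 0 else alias t) <=
  K * nd * (T `^ (beta^-1 - 2^-1) * Num.sqrt A).
Proof.
pose X B t := if bad_draw t then 0
  else bsum B (fun h => if aliased t h then cabs (c h) else 0).
have cX : ((fun B => \sum_t mu t * X B t) @ \oo -->
    \sum_t mu t * (if bad_draw t then 0 else alias t))%classic.
  apply: cvg_big => [|t _]; first exact: add_continuous.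
  apply: cvgMr; rewrite /X; case: (bad_draw t); first exact: cvg_cst.
  exact: cvg_alias.
rewrite -(cvg_lim _ cX) //; apply: limr_le; first exact: cvgP cX.
apply: nearW => B.
(* Goodness of the draw is traded for a cutoff on h that does not depend on the draw, so that the
   average over draws can be taken inside the sum. *)
apply: le_trans (_ : \sum_t mu t * bsum B (fun h => if aliased t h then
    (if rh h `^ beta <= T then cabs (c h) else 0) else 0) <= _).
  apply: ler_sum => t _; rewrite ler_wpM2l ?draw_prob_ge0 // /X.
  case: ifPn => [_|gt].
    by apply: bsum_ge0 => h; case: ifP => // _; case: ifP => // _; exact: cabs_ge0.
  by apply: ler_bsum => h; case: ifP => // th; rewrite (good_draw_aliased gt th).
apply: le_trans (sum_aliased_le B _) _.
  by move=> h; case: ifP => // _; exact: cabs_ge0.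
rewrite ler_wpM2l ?mulr_ge0 ?(ltW nd_gt0) ?(ltW K0) //.
have -> : bsum B (fun h => (if rh h `^ beta <= T then cabs (c h) else 0) * W h) =
  bsum B (fun h => if rh h `^ beta <= T then cabs (c h) * W h else 0).
  by apply: eq_bsum => h; case: ifP; rewrite ?mul0r.
apply: bsum_coef_le; first by rewrite mulr_gt0 ?sqrtr_gt0 // powR_gt0 ?threshold_gt0.
rewrite exprMn sqr_sqrtr ?(ltW A0) //.
apply: le_trans (ler_wpM2l (sqr_ge0 _) (weightA B)).
rewrite -bsumZ; apply: ler_bsum => h; case: ifP => hT; last first.
  by rewrite mulr_ge0 ?sqr_ge0 // mulr_ge0 ?sqr_ge0 // (ltW (rhb0 h)).
rewrite exprMn mulrA ler_wpM2r ?sqr_ge0 // mulrC.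
exact: rho_sqr_le.
Qed.

End Aliasing.

(** * The median rule *)

Section MedianRule.
Variables (R : realType) (alpha beta delta A K q : R) (gamma : nat -> R) (d n m : nat).
Hypotheses (alpha0 : 0 < alpha) (gamma01 : forall j, 0 < gamma j <= 1).
Hypotheses (beta0 : 0 < beta) (beta2 : beta <= 2) (delta0 : 0 < delta).
Hypotheses (A0 : 0 < A) (K0 : 0 < K) (q01 : 0 < q <= 1) (n1 : (1 < n)%N).
Let gu := @prod_weight R gamma d.
Hypothesis weightA : forall B,
  bsum B (fun h => @rho R d alpha gamma h `^ beta * freq_pow delta h ^+ 2) <= A.
Hypothesis dualK : forall h : midx d, supp h != finset.set0 ->
  \sum_(t : draw d n | in_dual t h) draw_prob R t <= K * freq_pow delta h * n%:R `^ (delta - 1).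

Let nd : R := n%:R `^ (delta - 1).
Let T := threshold delta A K q n.
Let bad := @bad_draw R alpha beta delta A K q gamma d n.
Let bad_set (w : outcome d n m.*2.+1) := [set k | bad (w k)].
Let q0 : 0 < q. Proof. by case/andP: q01. Qed.

Lemma outcome_probE N (w : outcome d n N) : outcome_prob R w = \prod_k draw_prob R (w k).
Proof. by []. Qed.

Lemma outcome_prob_ge0 N (w : outcome d n N) : 0 <= outcome_prob R w.
Proof. by rewrite outcome_probE prodr_ge0 // => k _; exact: draw_prob_ge0. Qed.

Let prob_bad : \sum_(t | bad t) draw_prob R t <= q.
Proof. exact: (prob_bad_draw gamma01). Qed.

Lemma prob_bad_set a :
  \sum_(w : outcome d n m.*2.+1 | (a <= #|bad_set w|)%N) outcome_prob R w
    <= 2 ^+ (m.*2.+1) * q ^+ a.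
Proof.
exact: (prob_many_bad _ (@draw_prob_ge0 d n R) (sum_draw_prob1 R d n1) a q01 prob_bad).
Qed.

Lemma cabs_median_error (w : outcome d n m.*2.+1) (f : ('I_d -> R) -> R[i]) :
  let Q k := lattice_rule ((w k).1 : nat) (fun j => ((w k).2 j : nat)) f in
  cabs (integral_cube f - Mn_rule w f) <=
  `|median [seq cre (Q k) | k <- enum 'I_m.*2.+1] - cre (integral_cube f)| +
  `|median [seq cim (Q k) | k <- enum 'I_m.*2.+1] - cim (integral_cube f)|.
Proof.
apply: le_trans (cabs_le _) _; rewrite creB cimB.
by rewrite ![`|_ - median _|]distrC /Mn_rule /cmedian /= -!map_comp.
Qed.

Variable c : midx d -> R[i].
Hypothesis cball : korobov_ball alpha gu c.
Let f := fourier_fun c.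
Let alias (t : draw d n) := alias_error c (t.1 : nat) (fun j => (t.2 j : nat)).

Lemma draw_ok_gt0 (t : draw d n) : draw_ok t -> (0 < t.1)%N.
Proof. by case/andP => /primesP_prime /prime_gt0. Qed.

(** Each part of the median is no farther from the integral than that part of some good draw. The
    set [bad_set w] does not involve [c], so one event serves the whole unit ball. *)
Lemma det_error_le (w : outcome d n m.*2.+1) : (#|bad_set w| <= m)%N ->
  cabs (integral_cube f - Mn_rule w f) <= 2 * T `^ beta^-1.
Proof.
move=> bw; apply: le_trans (cabs_median_error w f) _.
have ok k : k \notin bad_set w -> (0 < (w k).1)%N.
  by rewrite inE negb_or negbK => /andP[/draw_ok_gt0].
have le_alias k : k \notin bad_set w -> alias (w k) <= T `^ beta^-1.
  by rewrite inE => bk; exact: (good_alias_le gamma01 beta0 beta2 A0 K0 q0 n1 cball bk).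
rewrite mulr_natl mulr2n lerD //; apply: (median_le_max bw) => k kb.
  apply: le_trans (le_alias k kb); apply: cre_lattice_error; first exact: ok.
  by case: cball.
apply: le_trans (le_alias k kb); apply: cim_lattice_error; first exact: ok.
by case: cball.
Qed.

(** With fewer than (m + 1)/2 bad draws, the median is compared with the average over good draws;
    otherwise the crude bound is multiplied by the probability of this event. *)
Lemma ran_error_le :
  \sum_(w : outcome d n m.*2.+1) outcome_prob R w * cabs (integral_cube f - Mn_rule w f)
  <= 8 * (K * nd * (T `^ (beta^-1 - 2^-1) * Num.sqrt A)) +
     2 * Num.sqrt A * (2 ^+ (m.*2.+1) * q ^+ (uphalf m.+1)).
Proof.
pose Y t := if bad t then 0 else alias t.
have alias0 t : 0 <= alias t by exact: alias_ge0 cball t.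
apply: le_trans (_ : \sum_(w : outcome d n m.*2.+1)
   (4 / m.+1%:R * ((\prod_k draw_prob R (w k)) * \sum_k Y (w k)) +
    (if (uphalf m.+1 <= #|bad_set w|)%N then 2 * Num.sqrt A * outcome_prob R w else 0)) <= _).
  apply: ler_sum => w _; rewrite -outcome_probE.
  have P0 := outcome_prob_ge0 w.
  have SY : 0 <= \sum_k Y (w k) by apply: sumr_ge0 => k _; rewrite /Y; case: ifP.
  have c0 : 0 <= 4 / m.+1%:R :> R by rewrite divr_ge0.
  (* Outcomes of probability zero may have p = 0, where the lattice error bounds do not apply. *)
  have [->|P1] := eqVneq (outcome_prob R w) 0.
    by rewrite !mul0r mulr0 add0r; case: ifP; rewrite ?mulr0.
  have ok k : (0 < (w k).1)%N.
    apply: draw_ok_gt0; apply: contraNT P1 => nok.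
    by rewrite outcome_probE (bigD1 k) //= /draw_prob (negPf nok) mul0r.
  have sc : abs_summable c by case: cball.
  have fre k := cre_lattice_error (fun j => ((w k).2 j : nat)) (ok k) sc.
  have fim k := cim_lattice_error (fun j => ((w k).2 j : nat)) (ok k) sc.
  have H1 := cabs_median_error w f.
  case: ifP => bw; last first.
    have bm : (#|bad_set w|.*2 <= m)%N.
      by move: bw; move: #|_| => b /negbT; clear; lia.
    rewrite addr0 mulrCA ler_wpM2l //; apply: (le_trans H1).
    have := lerD (median_le_mean fre bm) (median_le_mean fim bm).
    move=> /le_trans; apply.
    have -> : 4 / m.+1%:R = 2 / m.+1%:R + 2 / m.+1%:R :> R by rewrite -mulrDl -natrD.
    rewrite -mulrDl ler_wpM2l // ?addr_ge0 ?divr_ge0 //.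
    rewrite [leRHS](bigID (fun k => k \in bad_set w)) /=.
    rewrite [X in _ <= X + _]big1 ?add0r => [|k]; last by rewrite inE /Y => ->.
    by apply: ler_sum => k; rewrite inE /Y => /negPf ->.
  rewrite -[leLHS]add0r lerD ?mulr_ge0 // mulrC ler_wpM2r //; apply: (le_trans H1).
  have le_max k : alias (w k) <= Num.sqrt A.
    exact: (alias_le_max alpha0 gamma01 beta2 delta0 A0 weightA cball).
  (* The crude bound holds for every draw, so none has to be excluded. *)
  have b0 : (#|(finset.set0 : {set 'I_m.*2.+1})| <= m)%N by rewrite cards0.
  rewrite mulr_natl mulr2n lerD //.
    by apply: (median_le_max b0) => k _; exact: le_trans (fre k) (le_max k).
  by apply: (median_le_max b0) => k _; exact: le_trans (fim k) (le_max k).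
rewrite big_split /= -mulr_sumr lerD //.
  rewrite sum_prod_prob_sum //; last exact: sum_draw_prob1.
  have M := mean_good_alias_le gamma01 beta0 beta2 delta0 A0 K0 q0 n1 weightA dualK cball.
  have N8 : 4 / m.+1%:R * (m.*2.+1)%:R <= 8 :> R.
    rewrite mulrAC ler_pdivrMr ?ltr0n // -!natrM ler_nat -[8%N]/(4 * 2)%N.
    by rewrite -mulnA leq_mul2l mul2n doubleS leqW.
  rewrite mulrA; apply: ler_pM => //.
  by apply: sumr_ge0 => t _; rewrite mulr_ge0 ?draw_prob_ge0 // /Y; case: ifP.
rewrite -big_mkcond -mulr_sumr ler_wpM2l ?mulr_ge0 ?sqrtr_ge0 //.
exact: prob_bad_set.
Qed.

End MedianRule.

(** * Tail probabilities and convergence rates *)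

(** For x = [h n] the exponent on the right is the m with N = 2m + 1 draws. *)
Lemma powR_le_exp2 (R : realType) n (x : R) : (1 < n)%N -> 0 <= x ->
  n%:R `^ x <= 2 ^+ absz (Num.ceil (x * (ln n%:R / ln 2))).
Proof.
move=> n1 x0; have l2 : 0 < ln 2 :> R by rewrite ln_gt0 // ltr1n.
have nR : 0 < n%:R :> R by rewrite ltr0n ltnW.
have ln0 : 0 <= ln n%:R :> R by rewrite ln_ge0 // ler1n ltnW.
set y := x * _; have y0 : 0 <= y by rewrite mulr_ge0 // divr_ge0 // ltW.
have ym : y <= (absz (Num.ceil y))%:R.
  have c0 : 0 <= Num.ceil y by rewrite ceil_ge0; lra.
  by have := ceil_ge y; rewrite -{1}(gez0_abs c0).
rewrite -powR_mulrn // /powR !gt_eqF // ler_expR.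
rewrite -[leLHS](_ : y * ln 2 = _); first by rewrite ler_wpM2r // ltW.
by rewrite /y; field; rewrite gt_eqF.
Qed.

(** The square offsets the halving in [uphalf], and the quarter offsets 2 ^ (2m + 1) <= 4 ^ (m + 1);
    what remains is at most (2 ^ m) ^ (- a). *)
Lemma mean_tail_exponent (R : realType) n m (a : R) : (1 < n)%N -> 0 <= a ->
  n%:R <= 2 ^+ m :> R ->
  2 ^+ (m.*2.+1) * ((2 `^ (- a) / 4) ^+ 2) ^+ (uphalf m.+1) <= n%:R `^ (- a) :> R.
Proof.
move=> n1 a0 nm; set s := 2 `^ (- a) / 4.
have t0 : 0 < 2 `^ (- a) :> R by rewrite powR_gt0.
have t1 : 2 `^ (- a) <= 1 :> R.
  by rewrite -[leRHS](powRr0 2); apply: ler_powR; lra.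
have s0 : 0 < s by rewrite divr_gt0.
have s1 : s <= 1 by rewrite /s; lra.
apply: le_trans (_ : 4 ^+ m.+1 * s ^+ m.+1 <= _).
  apply: ler_pM; [exact: exprn_ge0|by rewrite exprn_ge0 ?sqr_ge0| |].
    have -> : 4 ^+ m.+1 = 2 ^+ (2 * m.+1) :> R by rewrite exprM; congr (_ ^+ _); rewrite -natrX.
    by rewrite ler_eXn2l ?ltr1n //; lia.
  by rewrite -exprM ler_wiXn2l ?(ltW s0) //; lia.
rewrite -exprMn mulrC divfK ?gt_eqF //.
apply: le_trans (_ : (2 `^ (- a)) ^+ m <= _); first by rewrite exprS ler_piMl ?exprn_ge0 // ltW.
have -> : (2 `^ (- a)) ^+ m = (2 ^+ m) `^ (- a) :> R.
  by rewrite -(powR_mulrn m (powR_ge0 _ _)) -(powR_mulrn m (ler0n R 2)) -!powRrM mulrC.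
have nR : 0 < n%:R :> R by rewrite ltr0n ltnW.
rewrite !powRN lef_pV2 ?posrE ?powR_gt0 ?exprn_gt0 //.
by apply: ge0_ler_powR => //; rewrite nnegrE ?exprn_ge0 ?ltW.
Qed.

Lemma majority_tail_exponent (R : realType) m (x : R) : 0 < x -> x <= 2 ^+ m ->
  2 ^+ (m.*2.+1) * 8^-1 ^+ m.+1 <= x^-1.
Proof.
move=> x0 xm; have p0 : 0 < 2 ^+ m :> R by rewrite exprn_gt0.
apply: le_trans (_ : (2 ^+ m)^-1 <= _); last by rewrite lef_pV2 // posrE.
rewrite -[leRHS]div1r ler_pdivlMr // exprVn mulrAC ler_pdivrMr ?exprn_gt0 // mul1r.
have -> : 8 ^+ m.+1 = 2 ^+ (3 * m.+1) :> R by rewrite exprM; congr (_ ^+ _); rewrite -natrX.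
by rewrite -exprD ler_eXn2l ?ltr1n //; lia.
Qed.

(** Since (1 + 3 delta)(1 - 4 delta) <= 1 - delta, the first exponent loses at most 4 alpha delta;
    the second loses a further delta/2. *)
Lemma exponent_rate (R : realType) (alpha eps delta : R) : 0 < alpha -> 0 < delta ->
  delta * (4 * alpha + 1) <= eps ->
  (delta - 1) * (alpha / (1 + 3 * delta)) <= - alpha + eps /\
  (delta - 1) * (alpha / (1 + 3 * delta)) + (delta - 1) / 2 <= - alpha - 2^-1 + eps.
Proof.
move=> a0 d0 de; have D0 : 0 < 1 + 3 * delta by lra.
have H : (delta - 1) * (alpha / (1 + 3 * delta)) <= - alpha * (1 - 4 * delta).
  rewrite mulrA ler_pdivrMr //.
  have : 0 <= alpha * delta ^+ 2 by rewrite mulr_ge0 ?sqr_ge0 // ltW.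
  by nra.
by split; lra.
Qed.

(* The two parts use the same good event with different admissible probabilities of
   a bad draw: [q1] is small enough for the tail of the mean error, [8^-1] suffices
   for the tail [n `^ (- h n)]. Neither depends on [h]. *)
Lemma Mn_error_bounds_uniform (R : realType) (alpha eps G : R) (gamma : nat -> R) :
  2^-1 < alpha -> (forall j, 0 < gamma j <= 1) -> 0 < eps ->
  exists2 C : R, 0 < C & forall d,
    \sum_(j < d) gamma j `^ (alpha^-1) <= G ->
    Mn_error_bounds alpha eps gamma d 2 C.
Proof.
move=> alpha2 g01 eps0; have alpha0 : 0 < alpha by lra.
(* The first bound ensures [beta] <= 2, the second keeps the loss in the exponents below [eps]. *)
pose delta := Num.min ((2 * alpha - 1) / 3) (eps / (4 * alpha + 1)).
have delta0 : 0 < delta by rewrite lt_min !divr_gt0 //; lra.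
have d1 : 3 * delta <= 2 * alpha - 1.
  by rewrite mulrC -ler_pdivlMr // /delta ge_min lexx.
have d2 : delta * (4 * alpha + 1) <= eps.
  by rewrite -ler_pdivlMr; [rewrite /delta ge_min lexx orbT|lra].
(* [alpha * beta - 2 * delta = 1 + delta] makes the weighted sums converge. *)
pose beta := (1 + 3 * delta) / alpha.
have beta0 : 0 < beta by rewrite divr_gt0 //; lra.
have beta2 : beta <= 2 by rewrite ler_pdivrMr //; lra.
have ab : alpha * beta = 1 + 3 * delta by rewrite mulrC divfK // gt_eqF.
have bV : beta^-1 = alpha / (1 + 3 * delta) by rewrite invf_div.
have [e2 e1] := exponent_rate alpha0 delta0 d2; rewrite -bV in e1 e2.
have e1' : delta - 1 + (delta - 1) * (beta^-1 - 2^-1) <= - alpha - 2^-1 + eps by lra.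
have ea : - (alpha + 2^-1) <= - alpha - 2^-1 + eps by lra.
have [K K0 dualK] := draw_prob_in_dual delta0.
pose A := expR (2 * (1 + delta^-1) * G); have A0 : 0 < A by exact: expR_gt0.
(* The event of many bad draws is to have probability at most n to the power - [alpha] - 1/2; this
   determines [q1]. *)
pose a := alpha + 2^-1; have a0 : 0 <= a by rewrite /a; lra.
pose q1 : R := (2 `^ (- a) / 4) ^+ 2.
have q1_gt0 : 0 < q1 by rewrite exprn_gt0 // divr_gt0 // powR_gt0.
have q1_01 : 0 < q1 <= 1.
  rewrite q1_gt0 /= expr_le1 ?divr_ge0 ?powR_ge0 //.
  have : 2 `^ (- a) <= 1 :> R by rewrite -[leRHS](powRr0 2); apply: ler_powR; lra.
  by lra.
have q2_01 : 0 < (8^-1 : R) <= 1 by apply/andP; split; lra.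
pose c1 := K * A / q1; have c1_gt0 : 0 < c1 by rewrite divr_gt0 // mulr_gt0.
pose c2 := K * A / 8^-1; have c2_gt0 : 0 < c2 by rewrite divr_gt0 ?mulr_gt0 ?invr_gt0.
pose C1 := 8 * K * c1 `^ (beta^-1 - 2^-1) * Num.sqrt A + 2 * Num.sqrt A.
pose C2 := 2 * c2 `^ beta^-1.
have C1_gt0 : 0 < C1.
  have sA : 0 < Num.sqrt A by rewrite sqrtr_gt0.
  by rewrite addr_gt0 ?mulr_gt0 // powR_gt0.
have C2_gt0 : 0 < C2 by rewrite mulr_gt0 // powR_gt0.
exists (C1 + C2) => [|d gG h h1 _]; first exact: addr_gt0.
have weightA B : bsum B (fun k : midx d =>
    @rho R d alpha gamma k `^ beta * freq_pow delta k ^+ 2) <= A.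
  exact: bsum_weight_le.
have dualK_d n (n1 : (1 < n)%N) (k : midx d) (sk : supp k != finset.set0) :=
  dualK d n k n1 sk.
split=> n n1; set m := absz (Num.ceil (h n * (ln n%:R / ln 2)));
  have nR : 0 < n%:R :> R by rewrite ltr0n ltnW.
- have h0 : 0 <= h n by exact: le_trans (h1 n).
  (* As [h n] >= 1, n is at most n to the power [h n]. *)
  have nm : n%:R <= 2 ^+ m :> R.
    apply: le_trans (powR_le_exp2 n1 h0).
    rewrite -[leLHS]powRr1 ?ler0n //; apply: ler_powR => //; by rewrite ler1n ltnW.
  apply: ge_ereal_sup => _ [c cball <-]; rewrite lee_fin.
  have := ran_error_le m alpha0 g01 beta0 beta2 delta0 A0 K0 q1_01 n1 weightA (dualK_d n n1) cball.
  move=> /le_trans; apply.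
  apply: le_trans (_ : C1 * n%:R `^ (- alpha - 2^-1 + eps) <= _); last first.
    by rewrite ler_wpM2r ?powR_ge0 // lerDl ltW.
  rewrite [leRHS]mulrDl lerD //.
    rewrite /threshold -/c1 powRM ?powR_ge0 ?(ltW c1_gt0) // -powRrM.
    set X := n%:R `^ (delta - 1); set Y := n%:R `^ _.
    have -> : 8 * (K * X * (c1 `^ (beta^-1 - 2^-1) * Y * Num.sqrt A)) =
      8 * K * c1 `^ (beta^-1 - 2^-1) * Num.sqrt A * (X * Y) by ring.
    rewrite ler_wpM2l ?mulr_ge0 ?powR_ge0 ?(ltW K0) ?sqrtr_ge0 //.
    rewrite /X /Y -powRD; last by rewrite (gt_eqF nR) implybT.
    by apply: (ler_powR _ e1'); rewrite ler1n ltnW.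
  rewrite ler_wpM2l ?mulr_ge0 ?sqrtr_ge0 //.
  apply: (le_trans (mean_tail_exponent n1 a0 nm)).
  by apply: (ler_powR _ ea); rewrite ler1n ltnW.
have h0 : 0 <= h n by exact: le_trans (h1 n).
have nm := powR_le_exp2 n1 h0; rewrite -/m in nm.
pose bad_set (w : outcome d n m.*2.+1) :=
  [set k | bad_draw alpha beta delta A K 8^-1 gamma (w k)].
have Pbad := prob_bad_set m g01 delta0 A0 K0 q2_01 n1 weightA (dualK_d n n1) m.+1.
have P1 : \sum_(w : outcome d n m.*2.+1) outcome_prob R w = 1.
  exact: (sum_prod_prob _ (sum_draw_prob1 R d n1)).
rewrite /prob_det_err_le -/m.
(* The total mass 1 is split: outcomes with at most m bad draws satisfy the error bound, the others
   form the exceptional event. *)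
rewrite lerBlDr -[leLHS]P1 [leLHS](bigID (fun w => (m < #|bad_set w|)%N)) /= addrC.
apply: lerD.
  rewrite [leRHS]big_mkcond [leLHS]big_mkcond; apply: ler_sum => w _.
  case: ifP => bw; last by case: ifP => // _; exact: outcome_prob_ge0.
  rewrite ifT //; apply/asboolP; apply: ge_ereal_sup => _ [c cball <-]; rewrite lee_fin.
  rewrite -leqNgt in bw.
  have := det_error_le g01 beta0 beta2 A0 K0 q2_01 n1 cball bw.
  move=> /le_trans; apply.
  apply: le_trans (_ : C2 * n%:R `^ (- alpha + eps) <= _); last first.
    by rewrite ler_wpM2r ?powR_ge0 // lerDr ltW.
  rewrite /threshold -/c2 powRM ?powR_ge0 ?(ltW c2_gt0) // -powRrM mulrA ler_wpM2l ?(ltW C2_gt0) //.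
  by apply: ler_powR => //; rewrite ler1n ltnW.
apply: (le_trans Pbad); rewrite powRN; apply: majority_tail_exponent nm.
exact: powR_gt0.
Qed.

Theorem theorem1 (R : realType) (alpha : R) (gamma : nat -> R) (eps : R) :
  2^-1 < alpha ->
  (forall j : nat, 0 < gamma j <= 1) ->
  0 < eps ->
  (forall d : nat, (0 < d)%N ->
     exists n0 : nat, exists C : R,
       (0 < n0)%N /\ 0 < C /\ Mn_error_bounds alpha eps gamma d n0 C)
  /\
  ((\sum_(j <oo) ((gamma j) `^ (alpha^-1))%:E < +oo)%E ->
     exists n0 : nat, exists C : R,
       (0 < n0)%N /\ 0 < C /\
       forall d : nat, (0 < d)%N -> Mn_error_bounds alpha eps gamma d n0 C).
Proof.
move=> alpha2 g01 eps0; split=> [d _|gsum].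
  have [C C0 HC] := Mn_error_bounds_uniform (\sum_(j < d) gamma j `^ (alpha^-1)) alpha2 g01 eps0.
  by exists 2%N, C; do 2!split => //; exact: HC.
(* The full series bounds the partial sums for all d at once, so C is the same in every
   dimension. *)
pose G := (\sum_(j <oo) ((gamma j) `^ (alpha^-1))%:E)%E.
have [C C0 HC] := Mn_error_bounds_uniform (fine G) alpha2 g01 eps0.
exists 2%N, C; do 2!split => //; move=> d _; apply: HC.
have G0 : (0 <= G)%E by apply: nneseries_ge0 => j _ _; rewrite lee_fin powR_ge0.
rewrite -lee_fin fineK ?ge0_fin_numE // -sumEFin.
rewrite -(big_mkord xpredT (fun j => (gamma j `^ alpha^-1)%:E)).
by apply: nneseries_lim_ge => j _ _; rewrite lee_fin powR_ge0.
Qed.
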